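(* Let $(\Lambda,\eta)$ be an isothermic surface in $S^{3}$. Fix a non-zero $w\in\mathbb{R}^{4,1}$ and consider the lift $F:\Sigma\to E(w)$ of $\Lambda$. Let $(u,v)$ be conformal curvature line coordinates corresponding to $\eta$, so that the first and second fundamental forms of $F$ (with respect to a unit normal in $E(w)$) are given by $$I=e^{2\theta}(\mathrm{d}u^{2}+\mathrm{d}v^{2}),\qquad I\!I=e^{2\theta}(k_{1}\mathrm{d}u^{2}+k_{2}\mathrm{d}v^{2}).$$ Let $H=\frac{k_{1}+k_{2}}{2}$ be the mean curvature of $F$ and set $L=e^{2\theta}(k_{1}-k_{2})$ and $M=-HL$. Then $(\Lambda,\eta)$ is special isothermic of type $2$ in $E(w)$ if and only if there are real constants $A$, $B$ and $C$ such that $$\begin{cases} H_{uu}+\theta_{u}H_{u}-\theta_{v}H_{v}-\frac{1}{2}Mk_{1}-Ak_{1}-Be^{-2\theta}+C-\frac{1}{2}L(w,w)=0,\\ H_{vv}-\theta_{u}H_{u}+\theta_{v}H_{v}+\frac{1}{2}Mk_{2}+Ak_{2}-Be^{-2\theta}-C+\frac{1}{2}L(w,w)=0. \end{cases}$$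
   Context: $\mathbb{R}^{4,1}$ denotes $\mathbb{R}^{5}$ with an inner product $(\cdot,\cdot)$ of signature $(4,1)$, $\mathcal{L}$ its light-cone, and $S^3\cong\mathbb{P}(\mathcal{L})$. $\Sigma$ is a connected smooth surface, $\underline{\mathbb{R}}^{4,1}=\Sigma\times\mathbb{R}^{4,1}$, with trivial flat connection $\mathrm{d}$. A map $\Sigma\to S^3$ is identified with a null line subbundle $\Lambda\subset\underline{\mathbb{R}}^{4,1}$; a lift is a never-vanishing section $F$ of $\Lambda$; $\Lambda$ is an immersion iff $\langle F,\mathrm{d}F(T\Sigma)\rangle$ is a subbundle of rank $3$. Identify $\bigwedge^2\mathbb{R}^{4,1}$ with $\mathrm{o}(\mathbb{R}^{4,1})$ by $(u\wedge v)w=(u,w)v-(v,w)u$. An isothermic surface $(\Lambda,\eta)$ in $S^3$ is an immersion $\Lambda$ with a non-zero closed $1$-form $\eta\in\Omega^1\otimes\mathrm{o}(\mathbb{R}^{4,1})$ taking values in $\Lambda\wedge\Lambda^{\perp}$. Conformal curvature line coordinates $(u,v)$ are coordinates for which $I=e^{2\theta}(\mathrm{d}u^2+\mathrm{d}v^2)$ and $\partial_u,\partial_v$ diagonalise the shape operators; they correspond to $\eta$ when, for any lift $F$ with $(\mathrm{d}F,\mathrm{d}F)=e^{2\theta}(\mathrm{d}u^2+\mathrm{d}v^2)$, $\eta=e^{-2\theta}F\wedge(-F_u\,\mathrm{d}u+F_v\,\mathrm{d}v)$. For $w\ne 0$, $E(w):=\{v\in\mathcal{L}:(v,w)=-1\}$,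 a $3$-dimensional submanifold whose induced metric has constant sectional curvature $-(w,w)$; it is assumed that $\Lambda$ has a lift with values in $E(w)$. A polynomial conserved quantity of $(\Lambda,\eta)$ is a non-zero polynomial $p(t)=\sum_k p_kt^k$ with $p_k\in\Gamma(\underline{\mathbb{R}}^{4,1})$ such that $(\mathrm{d}+t\eta)p(t)=0$ for all $t\in\mathbb R$. $(\Lambda,\eta)$ is special isothermic of type $d$ in the space-form $E(w)$ if it admits a polynomial conserved quantity of degree $d$ with $p_0\in\langle w\rangle$. *)

(* Defs.v *)
From HB Require Import structures.
From mathcomp Require Import all_boot all_order all_algebra.
From mathcomp Require Import all_classical all_reals all_analysis.
Set Implicit Arguments.
Unset Strict Implicit.
Unset Printing Implicit Defensive.
Import Order.TTheory GRing.Theory Num.Theory.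
Import numFieldNormedType.Exports.
Local Open Scope classical_set_scope.
Local Open Scope ring_scope.

Notation plane R := (R^o * R^o)%type.
Notation vec5 R := 'cV[R]_5.

(* The surface is the domain U (open and connected) of the coordinates (u,v).
   A tangent vector is a pair X = (du X, dv X), and d f (X) is 'D_X f. *)
Definition e_u {R : realType} : plane R := (1, 0).
Definition e_v {R : realType} : plane R := (0, 1).

Section Smooth.
Context {R : realType} {W : normedModType R}.

Fixpoint Ck (n : nat) (U : set (plane R)) (f : plane R -> W) : Prop :=
  (forall x, U x -> {for x, continuous f}) /\
  if n is m.+1 then
    forall X : plane R,
      (forall x, U x -> derivable f x X) /\ Ck m U ('D_X f)
  else True.

Definition smooth (U : set (plane R)) (f : plane R -> W) : Prop :=
  forall n, Ck n U f.

End Smooth.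

Section Lorentz.
Context {R : realType}.
Implicit Types (J : 'M[R]_5) (a b w : vec5 R).

(* J is the Gram matrix of an inner product of signature (4,1) on R^5. *)
Definition signature41 J : Prop :=
  exists2 P : 'M[R]_5, P \in unitmx &
    J = P^T *m diag_mx (\row_(i < 5) (if i == ord_max then -1 else 1)) *m P.

Definition ip J a b : R := (a^T *m J *m b) 0 0.

(* The matrix of the endomorphism w |-> (a,w) b - (b,w) a; see wedgeE. *)
Definition wedge J a b : 'M[R]_5 := b *m a^T *m J - a *m b^T *m J.

Lemma wedgeE J a b w : wedge J a b *m w = ip J a w *: b - ip J b w *: a.
Proof.
have aux c d : c *m d^T *m J *m w = ip J d w *: c.
  rewrite -!mulmxA [d^T *m _]mx11_scalar mul_mx_scalar.
  by rewrite /ip mulmxA.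
by rewrite /wedge mulmxBl !aux.
Qed.

Definition space_form J w : set (vec5 R) :=
  [set a | ip J a a = 0 /\ ip J a w = -1].

End Lorentz.

Section Surfaces.
Context {R : realType}.
Variable J : 'M[R]_5.
Implicit Types (U : set (plane R)) (Lam : plane R -> {vspace vec5 R}).
Implicit Types (F N : plane R -> vec5 R) (theta : plane R -> R^o).
Implicit Types (eta : plane R -> {linear plane R -> 'M[R]_5}).

Definition is_lift U Lam F : Prop :=
  smooth U F /\ forall x, U x -> F x \in Lam x /\ F x != 0.

Definition null_line_subbundle U Lam : Prop :=
  (forall x, U x -> \dim (Lam x) = 1%N /\
     forall a, a \in Lam x -> ip J a a = 0) /\
  (forall x, U x -> exists V F,
     [/\ open V, V `<=` U, V x & is_lift V Lam F]).

Definition immersed U Lam : Prop :=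
  forall V F, open V -> V `<=` U -> is_lift V Lam F ->
  forall x, V x -> \dim <<[:: F x; 'D_e_u F x; 'D_e_v F x]>>%VS = 3%N.

Definition perp (S : {vspace vec5 R}) : set (vec5 R) :=
  [set b | forall a, a \in S -> ip J a b = 0].

Definition smooth_form U eta : Prop :=
  forall X, smooth U (fun x => eta x X).

(* d eta (X,Y) for constant vector fields X, Y, which commute. *)
Definition closed_form U eta : Prop :=
  forall x, U x -> forall X Y : plane R,
  'D_X (fun y => eta y Y) x - 'D_Y (fun y => eta y X) x = 0.

(* Since Lam x is a line, the elements of Lam /\ Lam^perp are all
   decomposable. *)
Definition isothermic U Lam eta : Prop :=
  [/\ null_line_subbundle U Lam /\ immersed U Lam,
      smooth_form U eta,
      closed_form U eta,
      exists x X, U x /\ eta x X != 0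
    & forall x X, U x -> exists a b,
        [/\ a \in Lam x, perp (Lam x) b & eta x X = wedge J a b]].

(* I = e^{2 theta} (du^2 + dv^2) *)
Definition conformal U F theta : Prop :=
  forall x, U x -> forall X Y : plane R,
  ip J ('D_X F x) ('D_Y F x) =
  expR (2 * theta x) * (X.1 * Y.1 + X.2 * Y.2).

(* eta = e^{-2 theta} F /\ (- F_u du + F_v dv) *)
Definition coordinates_correspond U Lam eta : Prop :=
  forall F theta, is_lift U Lam F -> smooth U theta -> conformal U F theta ->
  forall x, U x -> forall X : plane R,
  eta x X = expR (- 2 * theta x) *:
    wedge J (F x) (- (X.1 *: 'D_e_u F x) + X.2 *: 'D_e_v F x).

(* The tangent space of E(w) at F is the orthogonal complement of F and w. *)
Definition unit_normal U w F N : Prop :=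
  smooth U N /\ forall x, U x ->
  [/\ ip J (N x) (N x) = 1, ip J (N x) (F x) = 0, ip J (N x) w = 0
    & forall X : plane R, ip J (N x) ('D_X F x) = 0].

(* II = e^{2 theta} (k1 du^2 + k2 dv^2).  As N is orthogonal to the normal
   space <F, w> of E(w) in R^5, (N, nabla_X F_Y) = (N, X (Y F)) for the
   Levi-Civita connection nabla of E(w). *)
Definition second_form U F N theta (k1 k2 : plane R -> R^o) : Prop :=
  forall x, U x -> forall X Y : plane R,
  ip J ('D_X ('D_Y F) x) (N x) =
  expR (2 * theta x) * (k1 x * (X.1 * Y.1) + k2 x * (X.2 * Y.2)).

Definition peval (d : nat) (p : nat -> plane R -> vec5 R) (t : R)
  : plane R -> vec5 R := fun x => \sum_(k < d.+1) t ^+ k *: p k x.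

(* p_0 + p_1 t + ... + p_d t^d is a polynomial conserved quantity whose
   degree is d: the section p_d is not identically zero on U. *)
Definition conserved_quantity U eta (d : nat) (p : nat -> plane R -> vec5 R)
  : Prop :=
  [/\ forall k, (k <= d)%N -> smooth U (p k),
      exists x, U x /\ p d x != 0
    & forall (t : R) x (X : plane R), U x ->
        'D_X (peval d p t) x + t *: (eta x X *m peval d p t x) = 0].

Definition special_isothermic U Lam eta (d : nat) (w : vec5 R) : Prop :=
  isothermic U Lam eta /\
  exists p, conserved_quantity U eta d p /\
    forall x, U x -> p 0%N x \in <[w]>%VS.

End Surfaces.

(* Main.v *)
Require Import Defs.
From HB Require Import structures.
From mathcomp Require Import all_boot all_order all_algebra.
From mathcomp Require Import all_classical all_reals all_analysis.
From mathcomp Require Import ring lra.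
Import Order.TTheory GRing.Theory Num.Theory.
Import numFieldNormedType.Exports.
Local Open Scope classical_set_scope.
Local Open Scope ring_scope.

(** Along a surface F in E(w) the vectors F, F_u, F_v, N, w form a basis of
    R^{4,1} whose Gram matrix involves only exp(2 theta) and (w,w).  Every
    section is therefore determined by its inner products with this frame, and
    differentiating the Gram table gives the derivatives of the frame itself:
    the Gauss formulas (gauss_formulas), the Weingarten formulas (weingarten)
    and the Codazzi equations (codazzi).  In terms of H and
    L = exp(2 theta) (k1 - k2) the latter read L_u = 2 exp(2 theta) H_u and
    L_v = - 2 exp(2 theta) H_v, so that M = - H L has M_u = - k1 L_u and
    M_v = - k2 L_v, and L_uv = L_vu becomes H_uv = - theta_v H_u - theta_u H_v.

    Let p = p_0 + t p_1 + t^2 p_2 be a conserved quantity with p_0 in <w>.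
    Comparing powers of t, p_0 = a w is constant, d p_1 = - a eta w,
    d p_2 = - eta p_1 and eta p_2 = 0.  The last equation makes p_2 orthogonal
    to F, F_u and F_v, and the one before then forces p_2 = b (H F + N) with b
    constant, nonzero because p_2 is not identically zero, together with
      (p_1,F) = - b L / 2,  (p_1,F_u) = - b exp(2 theta) H_u,
      (p_1,F_v) = b exp(2 theta) H_v.
    The equation for d p_1 shows that s = (p_1,w) is constant and that (p_1,N)
    has the same derivative as - b M / 2, hence (p_1,N) = m - b M / 2 with m
    constant.  All inner products of p_1 with the frame are now known.
    Differentiating (p_1,F_u) along u and (p_1,F_v) along v gives the two
    equations, with A = - m / b, B = a / b and C = s / b
    (mean_curvature_equations_of_conserved).

    Conversely, these formulas with b = 1 define p_1 and p_2 from H, L and the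
    constants, and the two equations, with the formula for H_uv, are exactly
    what makes d p_1 = - B eta w hold
    (conserved_of_mean_curvature_equations).

    The analysis behind this consists of three facts about smooth functions of
    two variables, all consequences of the mean value theorem: D_X f is linear
    in X (derive_addv), second derivatives commute (derive_comm), and a
    function with zero derivative on a connected open set is constant
    (derive0_const). *)

(** * Directional derivatives *)

Section DirectionalDerivatives.
Context {R : realType} {V : normedModType R}.

Lemma open_near_eq {T : Type} (U : set V) (f g : V -> T) x :
  open U -> U x -> (forall y, U y -> f y = g y) -> \near x, f x = g x.
Proof.
move=> oU Ux fg; have : nbhs x U by exact: open_nbhs_nbhs.
by apply: filterS => y; exact: fg.
Qed.

Lemma continuous_on {T : topologicalType} {U : set V} {f g : V -> T} {x} :
  open U -> U x -> (forall y, U y -> f y = g y) ->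
  {for x, continuous f} -> {for x, continuous g}.
Proof.
move=> oU Ux fg cf; change (g @ x --> g x); rewrite -(fg x Ux).
apply: cvg_trans cf; apply: near_eq_cvg.
exact: open_near_eq oU Ux fg.
Qed.

Lemma is_derive_on {W : normedModType R} {U : set V} {f g : V -> W} {x v df} :
  open U -> U x -> (forall y, U y -> f y = g y) ->
  is_derive x v f df -> is_derive x v g df.
Proof.
by move=> oU Ux fg; apply: near_eq_is_derive; exact: open_near_eq fg.
Qed.

Lemma derive_on {W : normedModType R} {U : set V} {f g : V -> W} {x} v :
  open U -> U x -> (forall y, U y -> f y = g y) -> 'D_v f x = 'D_v g x.
Proof. by move=> oU Ux fg; apply: near_eq_derive; exact: open_near_eq fg. Qed.

(** Reduces derivatives in a direction to derivatives of functions of one real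
    variable, for which the chain rule and the mean value theorem are
    available. *)
Lemma is_derive_line {W : normedModType R} (f : V -> W) x v t df :
  is_derive (t *: v + x) v f df ->
  is_derive t 1 (fun h : R => f (h *: v + x)) df.
Proof.
have e : (fun h : R => h^-1 *: (((fun h0 : R => f (h0 *: v + x)) \o shift t)
    (h *: 1) - f (t *: v + x)))
   = (fun h : R => h^-1 *: ((f \o shift (t *: v + x)) (h *: v)
       - f (t *: v + x))).
  apply/funext => h /=; congr (_ *: (f _ - _)).
  by rewrite [h *: 1]mulr1 scalerDl addrA.
by move=> [d1 d2]; split; rewrite /derivable /derive e.
Qed.

Lemma is_derive_line0 {W : normedModType R} (f : V -> W) x v df :
  is_derive (0 : R) 1 (fun h : R => f (h *: v + x)) df -> is_derive x v f df.
Proof.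
have e : (fun h : R => h^-1 *: (((fun h0 : R => f (h0 *: v + x)) \o shift 0)
    (h *: 1) - f (0 *: v + x)))
   = (fun h : R => h^-1 *: ((f \o shift x) (h *: v) - f x)).
  apply/funext => h /=; congr (_ *: (f _ - f _)).
    by rewrite [h *: 1]mulr1 addr0.
  by rewrite scale0r add0r.
by move=> [d1 d2]; split; move: d1 d2; rewrite /derivable /derive e.
Qed.

Lemma is_derive_expR_comp (f : V -> R^o) x v (df : R) :
  is_derive x v f df ->
  is_derive x v (fun y => expR (f y) : R^o) (expR (f x) * df).
Proof.
move=> dfx; apply: is_derive_line0.
have dl : is_derive (0 : R) 1 (fun h : R => f (h *: v + x)) df.
  by apply: is_derive_line; rewrite scale0r add0r.
have := @is_derive1_comp _ expR _ _ _ _ (is_derive_expR _) dl.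
by rewrite scale0r add0r.
Qed.

Lemma mvt_line (f : V -> R^o) x v (h : R) : 0 < h ->
  (forall t, 0 <= t <= h -> derivable f (t *: v + x) v) ->
  exists2 t, 0 <= t <= h & f (h *: v + x) - f x = h * 'D_v f (t *: v + x).
Proof.
move=> h0 df.
have dg t : 0 <= t <= h -> is_derive t 1 (fun h : R => f (h *: v + x))
    ('D_v f (t *: v + x)).
  by move=> th; apply/is_derive_line/derivableP/df.
have [|| t tI e] := @MVT _ (fun h : R => f (h *: v + x))
    (fun t => 'D_v f (t *: v + x)) 0 h h0.
- move=> t /[!in_itv]/= /andP[t0 th]; apply: dg.
  by rewrite !ltW.
- apply: derivable_within_continuous => t /[!in_itv]/= th.
  by have [] := dg t th.
- exists t; first by move: tI; rewrite in_itv /= => /andP[? ?]; rewrite !ltW.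
  by move: e; rewrite scale0r add0r subr0 mulrC.
Qed.

Lemma is_derive_mx {m n} (F : V -> 'M[R]_(m.+1, n.+1)) x v dF :
  is_derive x v F dF <->
  forall i j, is_derive x v (fun y => F y i j : R^o) (dF i j).
Proof.
split=> [[d e] i j|d].
  split; first exact: (derivable_mxP F x v).1.
  by rewrite -e derive_mx// mxE.
have dF1 : derivable F x v by apply/derivable_mxP => i j; have [] := d i j.
split=> //; rewrite derive_mx//; apply/matrixP => i j.
by rewrite mxE; have [_] := d i j.
Qed.

Lemma is_deriveMf {V' : normedModType R} (f g : V' -> R^o) x v (df dg : R) :
  is_derive x v f df -> is_derive x v g dg ->
  is_derive x v (fun y => f y * g y : R^o) (f x * dg + g x * df).
Proof. exact: is_deriveM. Qed.

Lemma is_derive_cstM (k : R) (f : V -> R^o) x v (df : R) :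
  is_derive x v f df -> is_derive x v (fun y => k * f y : R^o) (k * df).
Proof.
move=> dfx; have := is_deriveMf _ _ _ _ _ _ (is_derive_cst (k : R^o) x v) dfx.
by rewrite mulr0 addr0.
Qed.

Lemma is_derive_scalev (f : V -> R^o) x v (c df : R) :
  is_derive x v f df -> is_derive x (c *: v) f (c * df).
Proof.
move=> dfx; apply: is_derive_line0.
have -> : (fun h : R => f (h *: (c *: v) + x)) =
    (fun t => f (t *: v + x)) \o (fun h => h * c).
  by apply/funext => h /=; rewrite scalerA.
rewrite mulrC; apply: is_derive1_comp.
  by apply: is_derive_line; rewrite mul0r scale0r add0r.
have := is_deriveMf id (cst c) 0 1 1 0 (is_derive_id _ _) (is_derive_cst _ _ _).
by rewrite mulr0 add0r mulr1.
Qed.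

Lemma is_derive_sumf {W : normedModType R} n (h : 'I_n -> V -> W) x v dh :
  (forall i, is_derive x v (h i) (dh i)) ->
  is_derive x v (fun y => \sum_(i < n) h i y) (\sum_(i < n) dh i).
Proof.
move=> d; have -> : (fun y => \sum_(i < n) h i y) = \sum_(i < n) h i.
  by apply/funext => y; rewrite fct_sumE.
exact: is_derive_sum.
Qed.

Lemma is_deriveZf {m n} (f : V -> R^o) (F : V -> 'M[R]_(m.+1, n.+1)) x v
    (df : R) dF :
  is_derive x v f df -> is_derive x v F dF ->
  is_derive x v (fun y => f y *: F y) (f x *: dF + df *: F x).
Proof.
move=> dfx /is_derive_mx dFx; apply/is_derive_mx => i j.
have -> : (fun y => (f y *: F y) i j) = (fun y => f y * F y i j).
  by apply/funext => y; rewrite mxE.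
rewrite !mxE [df * _]mulrC; exact: is_deriveMf.
Qed.

Lemma ip_sumE (J : 'M[R]_5) a b :
  ip J a b = \sum_(j < 5) (\sum_(i < 5) a i 0 * J i j) * b j 0.
Proof.
rewrite /ip mxE; apply: eq_bigr => j _; rewrite mxE; congr (_ * _).
by apply: eq_bigr => i _; rewrite mxE.
Qed.

Lemma is_derive_ip (J : 'M[R]_5) (F G : V -> vec5 R) x v dF dG :
  is_derive x v F dF -> is_derive x v G dG ->
  is_derive x v (fun y => ip J (F y) (G y) : R^o)
    (ip J dF (G x) + ip J (F x) dG).
Proof.
move=> /is_derive_mx dFx /is_derive_mx dGx.
have -> : (fun y => ip J (F y) (G y) : R^o) =
    (fun y => \sum_(j < 5) (\sum_(i < 5) F y i 0 * J i j) * G y j 0).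
  by apply/funext => y; rewrite ip_sumE.
rewrite !ip_sumE -big_split /=; apply: is_derive_sumf => j.
rewrite addrC [_ * G x j 0]mulrC; apply: is_deriveMf => //.
apply: is_derive_sumf => i.
have := is_deriveMf _ _ _ _ _ _ (dFx i 0) (is_derive_cst (J i j : R^o) x v).
by rewrite mulr0 add0r [J i j * _]mulrC.
Qed.

End DirectionalDerivatives.

(** * Consequences of the mean value theorem *)

Section MeanValue.
Context {R : realType} {V : normedModType R}.
Implicit Types (f A B C : V -> R^o) (x v : V).

Lemma small_parallelogram x v1 v2 (d : R) : 0 < d ->
  exists2 h : R, 0 < h & forall s t : R, 0 <= s <= h -> 0 <= t <= h ->
    ball x d (s *: v1 + (t *: v2 + x)).
Proof.
move=> d0; have n0 : 0 < `|v1| + `|v2| + 1 by rewrite ltr_wpDl// addr_ge0.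
exists (d / (`|v1| + `|v2| + 1)); first exact: divr_gt0.
move=> s t /andP[s0 sh] /andP[t0 th].
rewrite -ball_normE /ball_ /= distrC addrA addrK.
apply: (le_lt_trans (ler_normD _ _)); rewrite !normrZ !ger0_norm//.
apply: (@le_lt_trans _ _ (d / (`|v1| + `|v2| + 1) * (`|v1| + `|v2|))).
  by rewrite mulrDr lerD// ler_wpM2r.
rewrite mulrAC ltr_pdivrMr// ltr_pM2l//; lra.
Qed.

(** Passes to the limit in identities that the mean value theorem gives only at
    unspecified points near x. *)
Lemma continuous_eq_approx A B C x :
  {for x, continuous A} -> {for x, continuous B} -> {for x, continuous C} ->
  (forall d : R, 0 < d -> exists p q r,
     [/\ ball x d p, ball x d q, ball x d r & A p = B q + C r]) ->
  A x = B x + C x.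
Proof.
move=> cA cB cC app; apply/eqP; rewrite -subr_eq0 -normr_le0.
apply/ler_addgt0Pr => e e0; rewrite add0r.
have e3 : 0 < e / 3 by rewrite divr_gt0.
have near_ (f : V -> R^o) : {for x, continuous f} ->
    \forall y \near x, `|f x - f y| < e / 3.
  by move=> cf; move/cvgrPdist_lt : cf; exact.
have : nbhs x [set y | [/\ `|A x - A y| < e / 3, `|B x - B y| < e / 3
    & `|C x - C y| < e / 3]].
  near=> y; split; near: y; exact: near_.
move=> /nbhs_ballP[d /= d0 sub].
have [p [q [r [/sub[ap _ _] /sub[_ bq _] /sub[_ _ cr] E]]]] := app d d0.
rewrite (_ : A x - (B x + C x) = (A x - A p) - (B x - B q) - (C x - C r)).
  apply: (le_trans (ler_normB _ _)).
  have -> : e = e / 3 + e / 3 + e / 3 by lra.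
  rewrite lerD ?(ltW cr)//; apply: (le_trans (ler_normB _ _)).
  by rewrite lerD ?ltW.
rewrite E; ring.
Unshelve. all: by end_near. Qed.

(** The increment of f across a small parallelogram can be taken along the
    diagonal or along two consecutive sides; the mean value theorem turns it
    into values of the derivatives of f at nearby points, and these
    derivatives are continuous. *)
Lemma derive_addv f x v1 v2 (U : set V) : open U -> U x ->
  (forall y v, U y -> derivable f y v) ->
  (forall v, {for x, continuous ('D_v f)}) ->
  'D_(v1 + v2) f x = 'D_v1 f x + 'D_v2 f x.
Proof.
move=> oU Ux df cf.
apply: (continuous_eq_approx ('D_(v1 + v2) f) ('D_v1 f) ('D_v2 f)) => // d d0.
have /nbhs_ballP[d' /= d'0 dU] : nbhs x U by exact: open_nbhs_nbhs.
pose m := Num.min d d'.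
have m0 : 0 < m by rewrite lt_min d0.
have md y : ball x m y -> ball x d y.
  by apply: (@le_ball _ _ x m d); rewrite ge_min lexx.
have mU y : ball x m y -> U y.
  move=> my; apply: dU; apply: (@le_ball _ _ x m d' _ y my).
  by rewrite ge_min lexx orbT.
have [h h0 bh] := small_parallelogram x v1 v2 _ m0.
have hh : 0 <= h <= h by rewrite lexx ltW.
have z0 : 0 <= (0 : R) <= h by rewrite lexx ltW.
have bd t : 0 <= t <= h -> ball x m (t *: (v1 + v2) + x).
  by move=> th; rewrite scalerDr -addrA; exact: bh.
have b1 t : 0 <= t <= h -> ball x m (t *: v1 + (h *: v2 + x)).
  by move=> th; exact: bh.
have b2 t : 0 <= t <= h -> ball x m (t *: v2 + x).
  by move=> th; have := bh 0 t z0 th; rewrite scale0r add0r.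
have [|r rh er] := mvt_line f x (v1 + v2) h h0.
  by move=> t th; apply/df/mU/bd.
have [|p ph ep] := mvt_line f (h *: v2 + x) v1 h h0.
  by move=> t th; apply/df/mU/b1.
have [|q qh eq] := mvt_line f x v2 h h0.
  by move=> t th; apply/df/mU/b2.
exists (r *: (v1 + v2) + x), (p *: v1 + (h *: v2 + x)), (q *: v2 + x).
split; [exact/md/bd|exact/md/b1|exact/md/b2|].
apply: (mulfI (lt0r_neq0 h0)); rewrite mulrDr -er -ep -eq.
by rewrite scalerDr -addrA; ring.
Qed.

(** Schwarz' theorem: by the mean value theorem applied twice, the second
    difference of f over a small parallelogram is h^2 times a nearby value of
    either iterated derivative. *)
Lemma derive_comm f x v1 v2 (U : set V) : open U -> U x ->
  (forall y v, U y -> derivable f y v) ->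
  (forall y v w, U y -> derivable ('D_v f) y w) ->
  (forall v w, {for x, continuous ('D_w ('D_v f))}) ->
  'D_v1 ('D_v2 f) x = 'D_v2 ('D_v1 f) x.
Proof.
move=> oU Ux df ddf cf.
have /nbhs_ballP[d' /= d'0 dU] : nbhs x U by exact: open_nbhs_nbhs.
have second_difference (v w : V) (d : R) : 0 < d ->
    exists2 h0 : R, 0 < h0 & forall h : R, 0 < h <= h0 ->
      exists2 p, ball x d p &
        f (h *: v + (h *: w + x)) - f (h *: w + x) - (f (h *: v + x) - f x)
        = h ^+ 2 * 'D_w ('D_v f) p.
  move=> d0; pose m := Num.min d d'.
  have m0 : 0 < m by rewrite lt_min d0.
  have md y : ball x m y -> ball x d y.
    by apply: (@le_ball _ _ x m d); rewrite ge_min lexx.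
  have mU y : ball x m y -> U y.
    move=> my; apply: dU; apply: (@le_ball _ _ x m d' _ y my).
    by rewrite ge_min lexx orbT.
  have [h0 h00 bh] := small_parallelogram x v w _ m0.
  exists h0 => // h /andP[hp hh].
  have in0 t : 0 <= t <= h -> 0 <= t <= h0.
    by case/andP => -> /le_trans; exact.
  have hin : 0 <= h <= h by rewrite lexx ltW.
  have zin : 0 <= (0 : R) <= h by rewrite lexx ltW.
  (* The second difference of f is the first difference of g along v. *)
  pose g : V -> R^o := fun y => f (y + h *: w) - f y.
  have dg t : 0 <= t <= h -> is_derive (t *: v + x) v g
      ('D_v f (t *: v + (h *: w + x)) - 'D_v f (t *: v + x)).
    move=> th; have bt : U (t *: v + (h *: w + x)).
      by apply: mU; apply: bh; exact: in0.
    have bt0 : U (t *: v + x).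
      by have := bh t 0 (in0 _ th) (in0 _ zin); rewrite scale0r add0r => /mU.
    apply: is_deriveB; last exact/derivableP/df.
    have sh : (fun s : R => s^-1 *: (((fun y => f (y + h *: w) : R^o)
          \o shift (t *: v + x)) (s *: v) - f (t *: v + x + h *: w)))
        = (fun s : R => s^-1 *: ((f \o shift (t *: v + (h *: w + x))) (s *: v)
          - f (t *: v + (h *: w + x)))).
      by apply/funext => s; rewrite /= -!addrA [x + h *: w]addrC.
    have [d1 _] := derivableP (df _ v bt).
    by split; move: d1; rewrite /derivable /derive sh.
  have [|t th et] := mvt_line g x v h hp.
    by move=> t /dg[].
  have [|s sh es] := mvt_line ('D_v f) (t *: v + x) w h hp.
    move=> s sh; apply: ddf; rewrite addrCA; apply: mU; apply: bh; exact: in0.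
  exists (s *: w + (t *: v + x)).
    by rewrite addrCA; apply: md; apply: bh; exact: in0.
  have [_ eg] := dg t th.
  rewrite expr2 -mulrA -es [h *: w + (_ + _)]addrCA -eg -et /g.
  by rewrite -(addrA (h *: v) x) (addrC x (h *: w)); ring.
suff : 'D_v1 ('D_v2 f) x = 'D_v2 ('D_v1 f) x + cst (0 : R) x.
  by rewrite /cst addr0.
apply: (continuous_eq_approx ('D_v1 ('D_v2 f)) ('D_v2 ('D_v1 f)) (cst 0)) => //.
  exact: cst_continuous.
move=> d d0.
have [h1 h10 H1] := second_difference v1 v2 d d0.
have [h2 h20 H2] := second_difference v2 v1 d d0.
pose h := Num.min h1 h2.
have h0 : 0 < h by rewrite lt_min h10.
have [|p bp ep] := H1 h; first by rewrite h0 ge_min lexx.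
have [|q bq eq] := H2 h; first by rewrite h0 ge_min lexx orbT.
exists q, p, x; split=> //; first exact: ballxx.
apply: (mulfI (expf_neq0 2 (lt0r_neq0 h0))).
have swap : f (h *: v1 + (h *: v2 + x)) = f (h *: v2 + (h *: v1 + x)).
  by rewrite addrCA.
apply: (etrans (esym eq)); apply: (etrans _ (etrans ep _)); last first.
  exact: (esym (congr1 (fun z => h ^+ 2 * z) (addr0 _))).
by rewrite swap; ring.
Qed.

(** A function with vanishing derivatives is constant along segments, hence
    locally constant, hence constant on a connected open set. *)
Lemma derive0_const f (U : set V) : open U -> connected U ->
  (forall x v, U x -> is_derive x v f 0) ->
  forall x y, U x -> U y -> f x = f y.
Proof.
move=> oU cU df.
have locc x : U x -> \forall y \near x, f y = f x.
  move=> Ux; have /nbhs_ballP[d /= d0 dU] : nbhs x U by exact: open_nbhs_nbhs.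
  apply/nbhs_ballP; exists d => // y xy.
  have inU t : 0 <= t <= 1 -> U (t *: (y - x) + x).
    move=> /andP[t0 t1]; apply: dU; move: xy.
    rewrite -!ball_normE /ball_ /= !(distrC x) addrK normrZ (ger0_norm t0).
    by apply: le_lt_trans; rewrite ler_piMl.
  have [|t th] := mvt_line f x (y - x) 1 ltr01.
    by move=> t /inU Ut; have [] := df _ (y - x) Ut.
  have [_ ->] := df _ (y - x) (inU t th).
  by rewrite scale1r subrK mulr0 => /eqP; rewrite subr_eq0 => /eqP.
move=> x0 y0 Ux0 Uy0; pose B := [set y | U y /\ f y = f x0].
suff BU : B = U by have [] : B y0 by rewrite BU.
have open_sub (P : R -> Prop) : open [set y | U y /\ P (f y)].
  rewrite openE => y [Uy Py]; have nU : nbhs y U by exact: open_nbhs_nbhs.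
  apply: (@filterS _ (nbhs y) _ _ _ _ (filterI (locc y Uy) nU)) => z [/= fz Uz].
  by split=> //; rewrite fz.
apply: cU; first by exists x0.
- exists B; first exact: (open_sub (fun t => t = f x0)).
  by apply/seteqP; split=> [y [Uy e]|y [_ []]].
- exists (~` [set y | U y /\ f y <> f x0]).
    apply: open_closedC; exact: (open_sub (fun t => t <> f x0)).
  apply/seteqP; split=> y.
    by move=> [Uy e]; split=> // -[].
  by move=> [Uy ne]; split=> //; apply: contrapT => e; apply: ne.
Qed.

End MeanValue.

(** * Smooth functions on the plane *)

Section SmoothFunctions.
Context {R : realType}.
Context {U : set (plane R)} (oU : open U).

(** Being of class C^n on U only depends on the values on U.  This allows the
    formulas for derivatives, which hold on U only, to be used in inductions
    on n. *)
Lemma Ck_on {W : normedModType R} n (f g : plane R -> W) :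
  (forall x, U x -> f x = g x) -> Ck n U f -> Ck n U g.
Proof.
move=> fg; elim: n f g fg => [|n IH] f g fg [cf df].
  by split=> // x Ux; exact: continuous_on oU Ux fg (cf x Ux).
split=> [x Ux|]; first exact: continuous_on oU Ux fg (cf x Ux).
move=> X; have [dX CX] := df X; split.
  by move=> x Ux; have [] := is_derive_on oU Ux fg (derivableP (dX x Ux)).
by apply: IH CX => x Ux; exact: derive_on oU Ux fg.
Qed.

Lemma CkW {W : normedModType R} n (f : plane R -> W) : Ck n.+1 U f -> Ck n U f.
Proof.
elim: n f => [|n IH] f [cf df]; first by split.
by split=> // X; have [dX /IH] := df X; split.
Qed.

Lemma Ck_succ {W : normedModType R} n (f : plane R -> W)
    (df : plane R -> plane R -> W) :
  (forall x, U x -> {for x, continuous f}) ->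
  (forall X x, U x -> is_derive x X f (df X x)) ->
  (forall X, Ck n U (df X)) -> Ck n.+1 U f.
Proof.
move=> cf dfX CdX; split=> // X.
split=> [x Ux|]; first by have [] := dfX X x Ux.
by apply: Ck_on (CdX X) => x Ux; have [_ <-] := dfX X x Ux.
Qed.

Lemma Ck_continuous {W : normedModType R} n (f : plane R -> W) x :
  Ck n U f -> U x -> {for x, continuous f}.
Proof. by case: n => [|n] [cf _]; exact: cf. Qed.

Lemma Ck_is_derive {W : normedModType R} n (f : plane R -> W) x X :
  Ck n.+1 U f -> U x -> is_derive x X f ('D_X f x).
Proof. by move=> [_ /(_ X)[dX _]] /dX; exact: derivableP. Qed.

Lemma Ck_derive {W : normedModType R} n (f : plane R -> W) X :
  Ck n.+1 U f -> Ck n U ('D_X f).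
Proof. by move=> [_ /(_ X)[]]. Qed.

Lemma Ck_cst {W : normedModType R} n (a : W) : Ck n U (fun=> a).
Proof.
elim: n a => [|n IH] a; first by split=> // x _; exact: cst_continuous.
apply: (@Ck_succ _ _ _ (fun _ _ => 0)) => [x _|X].
  exact: cst_continuous.
exact: IH.
Qed.

Lemma CkD {W : normedModType R} n (f g : plane R -> W) :
  Ck n U f -> Ck n U g -> Ck n U (fun x => f x + g x).
Proof.
elim: n f g => [|n IH] f g Cf Cg; have cfg x : U x ->
    {for x, continuous (fun x => f x + g x)}.
- by move=> Ux; apply: continuousD; [case: Cf|case: Cg] => /(_ x Ux).
- by split.
- by move=> Ux; apply: continuousD; apply: Ck_continuous Ux; eassumption.
- apply: (@Ck_succ _ _ _ (fun X x => 'D_X f x + 'D_X g x)) => // X => [x Ux|].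
    by apply: is_deriveD; apply: Ck_is_derive Ux; eassumption.
  by apply: IH; exact: Ck_derive.
Qed.

Lemma CkM n (f g : plane R -> R^o) :
  Ck n U f -> Ck n U g -> Ck n U (fun x => f x * g x : R^o).
Proof.
elim: n f g => [|n IH] f g Cf Cg; have cfg x : U x ->
    {for x, continuous (fun x => f x * g x : R^o)}.
- by move=> Ux; apply: continuousM; [case: Cf|case: Cg] => /(_ x Ux).
- by split.
- by move=> Ux; apply: continuousM; apply: Ck_continuous Ux; eassumption.
- apply: (@Ck_succ _ _ _ (fun X x => f x * 'D_X g x + g x * 'D_X f x)) => // X.
    move=> x Ux.
    by apply: is_deriveMf; apply: Ck_is_derive Ux; eassumption.
  by apply: CkD; apply: IH; [exact: CkW|exact: Ck_derive|exact: CkW|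
    exact: Ck_derive].
Qed.

Lemma Ck_expR n (f : plane R -> R^o) :
  Ck n U f -> Ck n U (fun x => expR (f x) : R^o).
Proof.
elim: n f => [|n IH] f Cf; have cf x : U x ->
    {for x, continuous (fun x => expR (f x) : R^o)}.
- move=> Ux; apply: continuous_comp; first exact: Ck_continuous Cf Ux.
  exact: continuous_expR.
- by split.
- move=> Ux; apply: continuous_comp; first exact: Ck_continuous Cf Ux.
  exact: continuous_expR.
- apply: (@Ck_succ _ _ _ (fun X x => expR (f x) * 'D_X f x)) => // X.
    by move=> x Ux; apply: is_derive_expR_comp; exact: Ck_is_derive Cf Ux.
  by apply: CkM; [exact/IH/CkW|exact: Ck_derive].
Qed.

Lemma continuous_mx {m k} (F : plane R -> 'M[R]_(m.+1, k.+1)) x :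
  (forall i j, {for x, continuous (fun y => F y i j)}) -> {for x, continuous F}.
Proof.
move=> cF; apply/cvgrPdist_le => /= e e0.
near=> y; rewrite /Num.Def.normr/= mx_normrE (bigmax_le _ (ltW e0))//= => i _.
rewrite !mxE/=; move: i; near: y; apply: filter_forall => /= i.
exact: ((cvgrPdist_le _ _).1 (cF i.1 i.2)).
Unshelve. all: by end_near. Qed.

Lemma continuous_coord {m k} (F : plane R -> 'M[R]_(m.+1, k.+1)) x i j :
  {for x, continuous F} -> {for x, continuous (fun y => F y i j)}.
Proof.
move=> cF; apply: (@continuous_comp _ _ _ F (fun M => M i j)) => //.
exact: coord_continuous.
Qed.

Lemma Ck_mx n {m k} (F : plane R -> 'M[R]_(m.+1, k.+1)) :
  (forall i j, Ck n U (fun x => F x i j : R^o)) <-> Ck n U F.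
Proof.
elim: n F => [|n IH] F; split.
- move=> CF; split=> // x Ux; apply: continuous_mx => i j.
  exact: Ck_continuous (CF i j) Ux.
- move=> CF i j; split=> // x Ux; apply: continuous_coord.
  exact: Ck_continuous CF Ux.
- move=> CF; have dF X x : U x -> is_derive x X F ('D_X F x).
    move=> Ux; apply: derivableP; apply/derivable_mxP => i j.
    by have [] := Ck_is_derive _ _ _ X (CF i j) Ux.
  apply: (Ck_succ _ _ _ _ dF) => [x Ux|X].
    apply: continuous_mx => i j; exact: Ck_continuous (CF i j) Ux.
  apply/IH => i j; apply: (Ck_on _ _ _ _ (Ck_derive _ _ X (CF i j))) => x Ux.
  by have [_ ->] := (is_derive_mx _ _ _ _).1 (dF X x Ux) i j.
- move=> CF i j; apply: (@Ck_succ _ _ _ (fun X x => 'D_X F x i j)).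
  + move=> x Ux; apply: continuous_coord.
    exact: Ck_continuous CF Ux.
  + move=> X x Ux.
    exact: (is_derive_mx _ _ _ _).1 (Ck_is_derive _ _ _ X CF Ux) i j.
  + by move=> X; apply: (IH ('D_X F)).2; exact: Ck_derive.
Qed.

Lemma smooth_is_derive {W : normedModType R} {f : plane R -> W} {x} X :
  smooth U f -> U x -> is_derive x X f ('D_X f x).
Proof. by move=> /(_ 1%N); exact: Ck_is_derive. Qed.

Lemma smooth_derive {W : normedModType R} {f : plane R -> W} X :
  smooth U f -> smooth U ('D_X f).
Proof. by move=> Cf n; apply: Ck_derive; exact: Cf. Qed.

Lemma smooth_cst {W : normedModType R} (a : W) : smooth U (fun=> a).
Proof. by move=> n; exact: Ck_cst. Qed.

Lemma smoothD {W : normedModType R} {f g : plane R -> W} :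
  smooth U f -> smooth U g -> smooth U (fun x => f x + g x).
Proof. by move=> Cf Cg n; apply: CkD. Qed.

Lemma smoothM {f g : plane R -> R^o} :
  smooth U f -> smooth U g -> smooth U (fun x => f x * g x : R^o).
Proof. by move=> Cf Cg n; apply: CkM. Qed.

Lemma smoothN {f : plane R -> R^o} :
  smooth U f -> smooth U (fun x => - f x : R^o).
Proof.
move=> Cf; have -> : (fun x => - f x : R^o) = (fun x => -1 * f x).
  by apply/funext => x; rewrite mulN1r.
by apply: smoothM => //; exact: smooth_cst.
Qed.

Lemma smoothB {f g : plane R -> R^o} :
  smooth U f -> smooth U g -> smooth U (fun x => f x - g x : R^o).
Proof. by move=> Cf Cg; apply: smoothD => //; exact: smoothN. Qed.

Lemma smooth_expR {f : plane R -> R^o} :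
  smooth U f -> smooth U (fun x => expR (f x) : R^o).
Proof. by move=> Cf n; apply: Ck_expR. Qed.

Lemma smoothZ {m k} {f : plane R -> R^o} {F : plane R -> 'M[R]_(m.+1, k.+1)} :
  smooth U f -> smooth U F -> smooth U (fun x => f x *: F x).
Proof.
move=> Cf CF n; apply/Ck_mx => i j.
have -> : (fun x => (f x *: F x) i j : R^o) = (fun x => f x * F x i j).
  by apply/funext => x; rewrite mxE.
by apply: CkM => //; exact: (Ck_mx n F).2.
Qed.

Lemma smooth_ip J {F G : plane R -> vec5 R} :
  smooth U F -> smooth U G -> smooth U (fun x => ip J (F x) (G x) : R^o).
Proof.
move=> CF CG n.
have Csum (h : 'I_5 -> plane R -> R^o) : (forall i, Ck n U (h i)) ->
    Ck n U (fun x => \sum_(i < 5) h i x : R^o).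
  move=> Ch; have -> : (fun x => \sum_(i < 5) h i x : R^o) = \sum_(i < 5) h i.
    by apply/funext => x; rewrite fct_sumE.
  by elim/big_ind : _ => [|f g Cf Cg|//]; [exact: Ck_cst|exact: CkD].
apply: (Ck_on _
  (fun x => \sum_(j < 5) (\sum_(i < 5) F x i 0 * J i j) * G x j 0)).
  by move=> x _; rewrite ip_sumE.
apply: (Csum (fun j x => (\sum_(i < 5) F x i 0 * J i j) * G x j 0)) => j.
apply: CkM; last exact: (Ck_mx n G).2.
apply: (Csum (fun i x => F x i 0 * J i j)) => i.
by apply: CkM; [exact: (Ck_mx n F).2|exact: Ck_cst].
Qed.

Lemma smooth_derive_addv {f : plane R -> R^o} {x} X Y : smooth U f -> U x ->
  'D_(X + Y) f x = 'D_X f x + 'D_Y f x.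
Proof.
move=> Cf Ux; apply: (derive_addv _ _ _ _ U oU Ux).
  by move=> y v Uy; have [] := smooth_is_derive v Cf Uy.
by move=> v; exact: Ck_continuous (Ck_derive _ _ v (Cf 1%N)) Ux.
Qed.

Lemma plane_basis (X : plane R) : X = X.1 *: e_u + X.2 *: e_v.
Proof.
case: X => a b; rewrite /e_u /e_v; congr pair => /=.
  by rewrite [a *: 1]mulr1 [b *: 0]mulr0 addr0.
by rewrite [a *: 0]mulr0 [b *: 1]mulr1 add0r.
Qed.

Lemma smooth_deriveE {f : plane R -> R^o} {x} X : smooth U f -> U x ->
  'D_X f x = X.1 * 'D_e_u f x + X.2 * 'D_e_v f x.
Proof.
move=> Cf Ux; rewrite {1}(plane_basis X) smooth_derive_addv//.
have [_ ->] := is_derive_scalev _ _ _ X.1 _ (smooth_is_derive e_u Cf Ux).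
by have [_ ->] := is_derive_scalev _ _ _ X.2 _ (smooth_is_derive e_v Cf Ux).
Qed.

Lemma smooth_deriveC {f : plane R -> R^o} {x} X Y : smooth U f -> U x ->
  'D_X ('D_Y f) x = 'D_Y ('D_X f) x.
Proof.
move=> Cf Ux; apply: (derive_comm _ _ _ _ U oU Ux).
- by move=> y v Uy; have [] := smooth_is_derive v Cf Uy.
- by move=> y v w Uy; have [] := smooth_is_derive w (smooth_derive v Cf) Uy.
- move=> v w.
  exact: Ck_continuous (Ck_derive _ _ w (Ck_derive _ _ v (Cf 2%N))) Ux.
Qed.

Lemma smooth_mx {m k} {F : plane R -> 'M[R]_(m.+1, k.+1)} i j :
  smooth U F -> smooth U (fun x => F x i j : R^o).
Proof. by move=> CF n; exact: (Ck_mx n F).2. Qed.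

Lemma smooth_mx_derive {m k} {F : plane R -> 'M[R]_(m.+1, k.+1)} {x} X i j :
  smooth U F -> U x -> 'D_X F x i j = 'D_X (fun y => F y i j : R^o) x.
Proof.
move=> CF Ux.
by have [_ <-] := (is_derive_mx _ _ _ _).1 (smooth_is_derive X CF Ux) i j.
Qed.

Lemma smooth_mx_deriveE {m k} {F : plane R -> 'M[R]_(m.+1, k.+1)} {x} X :
  smooth U F -> U x -> 'D_X F x = X.1 *: 'D_e_u F x + X.2 *: 'D_e_v F x.
Proof.
move=> CF Ux; apply/matrixP => i j; rewrite [RHS]mxE.
have E Z : 'D_Z F x i j = 'D_Z (fun y => F y i j : R^o) x.
  exact: smooth_mx_derive.
apply: (etrans (E X)); apply: (etrans (smooth_deriveE X (smooth_mx i j CF) Ux)).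
congr (_ + _); rewrite [RHS]mxE; congr (_ * _); apply: esym; exact: E.
Qed.

Lemma smooth_mx_deriveC {m k} {F : plane R -> 'M[R]_(m.+1, k.+1)} {x} X Y :
  smooth U F -> U x -> 'D_X ('D_Y F) x = 'D_Y ('D_X F) x.
Proof.
move=> CF Ux; apply/matrixP => i j.
have E Z : forall y, U y -> 'D_Z F y i j = 'D_Z (fun y => F y i j : R^o) y.
  by move=> y; exact: smooth_mx_derive.
have CDF Z : smooth U ('D_Z F) by exact: smooth_derive.
rewrite [LHS](smooth_mx_derive X i j (CDF Y) Ux).
rewrite [RHS](smooth_mx_derive Y i j (CDF X) Ux).
have EX := derive_on X oU Ux (E Y); have EY := derive_on Y oU Ux (E X).
apply: (etrans EX); apply: (etrans _ (esym EY)).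
exact: smooth_deriveC (smooth_mx i j CF) Ux.
Qed.

Lemma smooth_const {f : plane R -> R^o} : connected U -> smooth U f ->
  (forall x, U x -> 'D_e_u f x = 0 /\ 'D_e_v f x = 0) ->
  forall x y, U x -> U y -> f x = f y.
Proof.
move=> cU Cf df; apply: derive0_const => // x X Ux.
have [du dv] := df x Ux; have E := smooth_deriveE X Cf Ux.
have := smooth_is_derive X Cf Ux; rewrite E du dv !mulr0 addr0.
exact.
Qed.

End SmoothFunctions.

(** * Linear algebra of the frame *)

Section InnerProduct.
Context {R : realType} (J : 'M[R]_5).
Implicit Types (a b c y z : vec5 R).

Lemma signature41_sym : signature41 J -> J^T = J.
Proof. by move=> [P _ ->]; rewrite !trmx_mul trmxK tr_diag_mx mulmxA. Qed.

Lemma ipDl a b c : ip J (a + b) c = ip J a c + ip J b c.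
Proof. by rewrite /ip linearD !mulmxDl mxE. Qed.

Lemma ipDr a b c : ip J c (a + b) = ip J c a + ip J c b.
Proof. by rewrite /ip !mulmxDr mxE. Qed.

Lemma ipZl (k : R) a b : ip J (k *: a) b = k * ip J a b.
Proof. by rewrite /ip linearZ -!scalemxAl mxE. Qed.

Lemma ipZr (k : R) a b : ip J a (k *: b) = k * ip J a b.
Proof. by rewrite /ip -!scalemxAr mxE. Qed.

Lemma ipNl a b : ip J (- a) b = - ip J a b.
Proof. by rewrite -scaleN1r ipZl mulN1r. Qed.

Lemma ipNr a b : ip J a (- b) = - ip J a b.
Proof. by rewrite -scaleN1r ipZr mulN1r. Qed.

Lemma ip0r a : ip J a 0 = 0.
Proof. by rewrite -(scale0r a) ipZr mul0r. Qed.

Lemma ip0l a : ip J 0 a = 0.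
Proof. by rewrite -(scale0r a) ipZl mul0r. Qed.

Definition ip_lin := (ipDl, ipDr, ipZl, ipZr, ipNl, ipNr, ip0l, ip0r).

Context (Jsym : J^T = J).

Lemma ipC a b : ip J a b = ip J b a.
Proof.
by rewrite {1}/ip -[in LHS](trmxK (_ *m b)) mxE !trmx_mul trmxK Jsym mulmxA.
Qed.

(** The vectors f, a, b, n stand for F, F_u, F_v, N at a point of a surface in
    E(w), and k for the value of exp(2 theta). *)
Record surface_frame (k c : R) (f a b n w : vec5 R) : Prop := SurfaceFrame {
  frame_ff : ip J f f = 0;   frame_fa : ip J f a = 0;
  frame_fb : ip J f b = 0;   frame_fn : ip J f n = 0;
  frame_fw : ip J f w = -1;  frame_aa : ip J a a = k;
  frame_ab : ip J a b = 0;   frame_an : ip J a n = 0;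
  frame_aw : ip J a w = 0;   frame_bb : ip J b b = k;
  frame_bn : ip J b n = 0;   frame_bw : ip J b w = 0;
  frame_nn : ip J n n = 1;   frame_nw : ip J n w = 0;
  frame_ww : ip J w w = c }.

(** The frame has the explicit dual basis -(w + c f), a / k, b / k, n, -f, so
    it is a basis and every vector is recovered from its inner products. *)
Lemma frame_expansion (k c : R) f a b n w :
  k != 0 -> surface_frame k c f a b n w ->
  forall y, y = - (ip J w y + c * ip J f y) *: f + (k^-1 * ip J a y) *: a
    + (k^-1 * ip J b y) *: b + ip J n y *: n - ip J f y *: w.
Proof.
move=> k0 [] ff fa fb fn fw aa ab an aw bb bn bw nn nw ww.
pose p := [:: f; a; b; n; w].
pose q := [:: - (w + c *: f); k^-1 *: a; k^-1 *: b; n; - f].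
pose P : 'M[R]_5 := \matrix_(i, j) p`_j i 0.
pose Q : 'M[R]_5 := \matrix_(i, j) q`_i j 0.
have QJ y i : (Q *m J *m y) i 0 = ip J q`_i y.
  rewrite /ip !mxE; apply: eq_bigr => j _; congr (_ * _); rewrite !mxE.
  by apply: eq_bigr => l _; rewrite !mxE.
have QJP : Q *m J *m P = 1%:M.
  apply/matrixP => i j.
  have -> : (Q *m J *m P) i j = ip J q`_i p`_j.
    rewrite -QJ [LHS]mxE [RHS]mxE; apply: eq_bigr => l _; congr (_ * _).
    by rewrite mxE.
  rewrite mxE.
  case: i => -[|[|[|[|[|i]]]]] //= li; case: j => -[|[|[|[|[|j]]]]] //= lj;
    rewrite ?ip_lin ?ff ?fa ?fb ?fn ?fw ?aa ?ab ?an ?aw ?bb ?bn ?bw ?nn ?nw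
      ?ww ?(ipC b a) ?(ipC a f) ?(ipC b f) ?(ipC n f) ?(ipC n a) ?(ipC n b)
      ?(ipC w f) ?(ipC w a) ?(ipC w b) ?(ipC w n)
      ?ff ?fa ?fb ?fn ?fw ?aa ?ab ?an ?aw ?bb ?bn ?bw ?nn ?nw ?ww
      ?(mulr0, addr0, oppr0, add0r, opprK, mulrN1, subrr) ?mulVf //.
have PQJ := mulmx1C QJP.
move=> y; rewrite -{1}(mul1mx y) -PQJ -mulmxA.
apply/colP => i; rewrite mxE.
rewrite (eq_bigr (fun j : 'I_5 => p`_j i 0 * ip J q`_j y)); last first.
  by move=> j _; rewrite QJ mxE.
rewrite !big_ord_recl big_ord0 /= !ip_lin !mxE; ring.
Qed.

Lemma frame_ext (k c : R) f a b n w y z :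
  k != 0 -> surface_frame k c f a b n w ->
  ip J f y = ip J f z -> ip J a y = ip J a z -> ip J b y = ip J b z ->
  ip J n y = ip J n z -> ip J w y = ip J w z -> y = z.
Proof.
move=> k0 fr ef ea eb en ew.
rewrite (frame_expansion _ _ _ _ _ _ _ k0 fr y) ef ea eb en ew.
by rewrite -(frame_expansion _ _ _ _ _ _ _ k0 fr z).
Qed.

Lemma frame_coordinates (k c : R) f a b n w y pf pa pb pn pw : k != 0 ->
  surface_frame k c f a b n w ->
  ip J y f = pf -> ip J y a = k * pa -> ip J y b = k * pb -> ip J y n = pn ->
  ip J y w = pw ->
  y = - (pw + c * pf) *: f + pa *: a + pb *: b + pn *: n - pf *: w.
Proof.
move=> k0 fr yf ya yb yn yw.
rewrite {1}(frame_expansion _ _ _ _ _ _ _ k0 fr y) !(ipC _ y) yf ya yb yn yw.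
by rewrite !mulKf.
Qed.

(** The vectors s.. stand for the second derivatives of F.  Their tangential
    components come, as for Christoffel symbols, from the derivatives of the
    first fundamental form and the symmetry suv = svu; the component along
    w + c f accounts for (F_X, F) = 0 and (F, w) = -1. *)
Lemma second_derivatives (k c : R) f a b n w (tu tv l1 l2 : R) suu suv svu svv :
  k != 0 -> surface_frame k c f a b n w -> suv = svu ->
  ip J suu f = - ip J a a -> ip J suv f = - ip J b a ->
  ip J svv f = - ip J b b ->
  ip J suu w = 0 -> ip J suv w = 0 -> ip J svv w = 0 ->
  ip J suu n = k * l1 -> ip J suv n = 0 -> ip J svv n = k * l2 ->
  ip J suu a + ip J a suu = k * (2 * tu) ->
  ip J svu a + ip J a svu = k * (2 * tv) ->
  ip J suv b + ip J b suv = k * (2 * tu) ->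
  ip J svv b + ip J b svv = k * (2 * tv) ->
  ip J suu b + ip J a suv = 0 -> ip J svu b + ip J a svv = 0 ->
  [/\ suu = tu *: a - tv *: b + (k * l1) *: n + k *: (w + c *: f),
      suv = tv *: a + tu *: b
    & svv = - tu *: a + tv *: b + (k * l2) *: n + k *: (w + c *: f)].
Proof.
move=> k0 fr <- uf mf vf uw mw vw un mn vn uua vua uvb vvb uub vub.
move: uf mf vf uua vua uvb vvb uub vub.
rewrite (frame_aa _ _ _ _ _ _ _ fr) (ipC b a) (frame_ab _ _ _ _ _ _ _ fr).
rewrite (frame_bb _ _ _ _ _ _ _ fr) !(ipC a) !(ipC b) oppr0.
move=> uf mf vf uua vua uvb vvb uub vub.
have ua : ip J suu a = k * tu by lra.
have ma : ip J suv a = k * tv by lra.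
have mb : ip J suv b = k * tu by lra.
have vb : ip J svv b = k * tv by lra.
have ub : ip J suu b = k * (- tv) by lra.
have va : ip J svv a = k * (- tu) by lra.
split.
- rewrite {1}(frame_coordinates _ _ _ _ _ _ _ _ _ _ _ _ _ k0 fr uf ua ub un uw).
  by apply/colP => i; rewrite !mxE; ring.
- rewrite {1}(frame_coordinates _ _ _ _ _ _ _ _ _ _ _ _ _ k0 fr mf ma mb mn mw).
  by apply/colP => i; rewrite !mxE; ring.
- rewrite {1}(frame_coordinates _ _ _ _ _ _ _ _ _ _ _ _ _ k0 fr vf va vb vn vw).
  by apply/colP => i; rewrite !mxE; ring.
Qed.

Lemma shape_operator (k c : R) f a b n w y z (la lb : R) :
  k != 0 -> surface_frame k c f a b n w ->
  ip J n z = 0 -> ip J y f + ip J n z = 0 -> ip J y n + ip J n y = 0 ->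
  ip J y w = 0 -> ip J y a = k * la -> ip J y b = k * lb ->
  y = la *: a + lb *: b.
Proof.
move=> k0 fr nz yf yn yw ya yb.
have yf0 : ip J y f = 0 by lra.
have yn0 : ip J y n = 0 by move: yn; rewrite (ipC n); lra.
rewrite {1}(frame_coordinates _ _ _ _ _ _ _ _ _ _ _ _ _ k0 fr yf0 ya yb yn0
  yw).
by apply/colP => i; rewrite !mxE; ring.
Qed.

(** Up to sign, the vectors below are the values at r w of the endomorphisms
    eta(e_u) and eta(e_v). *)
Lemma frame_form_w (k c : R) f a b n w (r : R) : surface_frame k c f a b n w ->
  k^-1 *: (ip J f (r *: w) *: a - ip J a (r *: w) *: f) = - (r * k^-1) *: a /\
  k^-1 *: (ip J f (r *: w) *: b - ip J b (r *: w) *: f) = - (r * k^-1) *: b.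
Proof.
move=> [ff fa fb fn fw aa ab an aw bb bn bw nn nw ww].
by rewrite !ip_lin fw aw bw; split; apply/colP => i; rewrite !mxE; ring.
Qed.

Lemma frame_form_kernel (k c : R) f a b n w y : k != 0 ->
  surface_frame k c f a b n w ->
  - (k^-1 *: (ip J f y *: a - ip J a y *: f)) = 0 ->
  k^-1 *: (ip J f y *: b - ip J b y *: f) = 0 ->
  [/\ ip J f y = 0, ip J a y = 0 & ip J b y = 0].
Proof.
move=> k0 [ff fa fb fn fw aa ab an aw bb bn bw nn nw ww] /eqP.
rewrite oppr_eq0 scaler_eq0 invr_eq0 (negPf k0) /= => /eqP za /eqP.
rewrite scaler_eq0 invr_eq0 (negPf k0) /= => /eqP zb.
have := congr1 (fun z => ip J z w) zb; have := congr1 (fun z => ip J z w) za.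
have := congr1 (fun z => ip J z a) za.
rewrite !ip_lin aa fa fw aw bw !(mulr0, subr0, sub0r) !mulrN1 !opprK.
by move=> /eqP; rewrite mulf_eq0 (negPf k0) orbF => /eqP -> -> ->.
Qed.

(** The equality of the mixed second derivatives nuv and nvu of N, read off in
    the directions F_u and F_v. *)
Lemma codazzi_of_normal (k c : R) f a b n w (tu tv l1 l2 l1v l2u : R)
    nu nv nuv nvu suu svu suv svv :
  k != 0 -> surface_frame k c f a b n w -> nuv = nvu ->
  nu = - l1 *: a -> nv = - l2 *: b ->
  suu = tu *: a - tv *: b + (k * l1) *: n + k *: (w + c *: f) ->
  svu = tv *: a + tu *: b -> suv = tv *: a + tu *: b ->
  svv = - tu *: a + tv *: b + (k * l2) *: n + k *: (w + c *: f) ->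
  ip J nuv a + ip J nu svu = - l1 * (k * (2 * tv)) + k * - l1v ->
  ip J nuv b + ip J nu svv = 0 -> ip J nvu a + ip J nv suu = 0 ->
  ip J nvu b + ip J nv suv = - l2 * (k * (2 * tu)) + k * - l2u ->
  l1v = tv * (l2 - l1) /\ l2u = tu * (l1 - l2).
Proof.
move=> k0 [ff fa fb fn fw aa ab an aw bb bn bw nn nw ww] <- -> -> -> -> -> ->.
rewrite !ip_lin (ipC b a) (ipC a f) (ipC b f) aa ab an aw bb bn bw fa fb.
by move=> *; split; apply: (mulfI k0); lra.
Qed.

End InnerProduct.

(** * Structure equations of a surface in a space form *)

Section StructureEquations.
Context {R : realType} {J : 'M[R]_5} {U : set (plane R)} {w : vec5 R}.
Context {F Fu Fv N : plane R -> vec5 R}.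
Context {E tu tv k1 k2 H L Hu Hv Huu Huv Hvv : plane R -> R^o}.
Local Notation c := (ip J w w).

(** E stands for exp(2 theta), and tu, tv for the derivatives of theta; the
    fields derive_L and HuvE carry the Codazzi equations.  The partial
    derivatives are independent symbols, so that what follows from these
    equations is algebra. *)
Record structure_equations : Prop := StructureEquations {
  frameP : forall x, U x ->
    surface_frame J (E x) c (F x) (Fu x) (Fv x) (N x) w;
  factor_neq0 : forall x, E x != 0;
  derive_F : forall x, U x ->
    is_derive x e_u F (Fu x) /\ is_derive x e_v F (Fv x);
  derive_Fu : forall x, U x ->
    is_derive x e_u Fu (tu x *: Fu x - tv x *: Fv x + (E x * k1 x) *: N x
      + E x *: (w + c *: F x)) /\
    is_derive x e_v Fu (tv x *: Fu x + tu x *: Fv x);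
  derive_Fv : forall x, U x ->
    is_derive x e_u Fv (tv x *: Fu x + tu x *: Fv x) /\
    is_derive x e_v Fv (- tu x *: Fu x + tv x *: Fv x + (E x * k2 x) *: N x
      + E x *: (w + c *: F x));
  derive_N : forall x, U x ->
    is_derive x e_u N (- k1 x *: Fu x) /\ is_derive x e_v N (- k2 x *: Fv x);
  derive_E : forall x, U x ->
    is_derive x e_u E (E x * (2 * tu x)) /\
    is_derive x e_v E (E x * (2 * tv x));
  meanE : forall x, H x = (k1 x + k2 x) / 2;
  skewE : forall x, L x = E x * (k1 x - k2 x);
  derive_H : forall x, U x ->
    is_derive x e_u H (Hu x) /\ is_derive x e_v H (Hv x);
  derive_L : forall x, U x ->
    is_derive x e_u L (2 * E x * Hu x) /\
    is_derive x e_v L (- 2 * E x * Hv x);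
  derive_Hu : forall x, U x ->
    is_derive x e_u Hu (Huu x) /\ is_derive x e_v Hu (Huv x);
  derive_Hv : forall x, U x ->
    is_derive x e_u Hv (Huv x) /\ is_derive x e_v Hv (Hvv x);
  HuvE : forall x, U x -> Huv x = - (tv x * Hu x + tu x * Hv x);
  smooth_F : smooth U F;   smooth_Fu : smooth U Fu;  smooth_Fv : smooth U Fv;
  smooth_N : smooth U N;   smooth_H : smooth U H;    smooth_L : smooth U L;
  smooth_Hu : smooth U Hu; smooth_Hv : smooth U Hv }.

End StructureEquations.

Arguments structure_equations {R} J U w F Fu Fv N
  E tu tv k1 k2 H L Hu Hv Huu Huv Hvv.

Lemma addr_eq0_opp {R : realType} (a b d : R) : a + b = 0 -> b = - d -> a = d.
Proof. by move=> h e; move: h; rewrite e => /eqP; rewrite subr_eq0 => /eqP. Qed.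

Section SurfaceGeometry.
Context {R : realType} (J : 'M[R]_5) (U : set (plane R)) (w : vec5 R).
Context (F N : plane R -> vec5 R) (theta k1 k2 : plane R -> R^o).
Context (Jsym : J^T = J) (oU : open U).
Context (sF : smooth U F) (hFw : forall x, U x -> space_form J w (F x)).
Context (stheta : smooth U theta) (sk1 : smooth U k1) (sk2 : smooth U k2).
Context (hI : conformal J U F theta) (hN : unit_normal J U w F N).
Context (hII : second_form J U F N theta k1 k2).

Local Notation Fu := ('D_e_u F).
Local Notation Fv := ('D_e_v F).
Local Notation c := (ip J w w).

Definition conformal_factor x : R^o := expR (2 * theta x).
Local Notation E := conformal_factor.

Lemma conformal_factor_neq0 x : E x != 0.
Proof. by rewrite gt_eqF// expR_gt0. Qed.

Lemma smooth_conformal_factor : smooth U E.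
Proof.
by apply: smooth_expR => //; apply: smoothM => //; exact: smooth_cst.
Qed.

Lemma is_derive_conformal_factor x X : U x ->
  is_derive x X E (E x * (2 * 'D_X theta x)).
Proof.
move=> Ux; apply: is_derive_expR_comp.
exact/is_derive_cstM/smooth_is_derive.
Qed.

Lemma derive_ip_on {A B : plane R -> vec5 R} {h : plane R -> R^o} {x X dh} :
  smooth U A -> smooth U B -> U x ->
  (forall y, U y -> ip J (A y) (B y) = h y) ->
  is_derive x X h dh -> ip J ('D_X A x) (B x) + ip J (A x) ('D_X B x) = dh.
Proof.
move=> sA sB Ux hh [_ <-].
have := is_derive_ip J _ _ _ _ _ _ (smooth_is_derive X sA Ux)
  (smooth_is_derive X sB Ux).
by move=> /(is_derive_on oU Ux hh)[_ ->].
Qed.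

Lemma derive_ip_cst {A B : plane R -> vec5 R} {a : R} {x} X :
  smooth U A -> smooth U B -> U x -> (forall y, U y -> ip J (A y) (B y) = a) ->
  ip J ('D_X A x) (B x) + ip J (A x) ('D_X B x) = 0.
Proof.
by move=> sA sB Ux hh; apply: (derive_ip_on (h := cst a)).
Qed.

Let sD X : smooth U ('D_X F). Proof. exact: smooth_derive. Qed.
Let sN : smooth U N. Proof. by case: hN. Qed.
Let scst (a : vec5 R) : smooth U (cst a). Proof. exact: smooth_cst. Qed.

Lemma lift_null x : U x -> ip J (F x) (F x) = 0.
Proof. by move=> /hFw[]. Qed.

Lemma lift_w x : U x -> ip J (F x) w = -1.
Proof. by move=> /hFw[]. Qed.

Lemma derive_cst_vec (a : vec5 R) x X : 'D_X (cst a : plane R -> vec5 R) x = 0.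
Proof. exact: derive_cst. Qed.

Lemma tangent_lift x X : U x -> ip J ('D_X F x) (F x) = 0.
Proof.
move=> Ux; have := derive_ip_cst X sF sF Ux lift_null.
rewrite (ipC J Jsym (F x)); lra.
Qed.

Lemma tangent_w x X : U x -> ip J ('D_X F x) w = 0.
Proof.
move=> Ux; have := derive_ip_cst X sF (scst w) Ux lift_w.
by rewrite derive_cst_vec ip0r addr0.
Qed.

Lemma second_derivative_w x X Y : U x -> ip J ('D_X ('D_Y F) x) w = 0.
Proof.
move=> Ux; have := derive_ip_cst X (sD Y) (scst w) Ux (fun y => tangent_w y Y).
by rewrite derive_cst_vec ip0r addr0.
Qed.

Lemma second_derivative_lift x X Y : U x ->
  ip J ('D_X ('D_Y F) x) (F x) = - ip J ('D_Y F x) ('D_X F x).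
Proof.
move=> Ux; have := derive_ip_cst X (sD Y) sF Ux (fun y => tangent_lift y Y).
lra.
Qed.

Lemma second_derivative_tangent x X Y Z : U x ->
  ip J ('D_X ('D_Y F) x) ('D_Z F x) + ip J ('D_Y F x) ('D_X ('D_Z F) x) =
  (Y.1 * Z.1 + Y.2 * Z.2) * (E x * (2 * 'D_X theta x)).
Proof.
move=> Ux; have := is_deriveMf E (cst (Y.1 * Z.1 + Y.2 * Z.2)) x X _ 0
  (is_derive_conformal_factor x X Ux) (is_derive_cst _ _ _).
rewrite mulr0 add0r; apply: (derive_ip_on (sD Y) (sD Z) Ux).
by move=> y Uy; exact: hI.
Qed.

Lemma normal_normal x : U x -> ip J (N x) (N x) = 1.
Proof. by case: hN => _ h /h[]. Qed.

Lemma normal_lift x : U x -> ip J (N x) (F x) = 0.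
Proof. by case: hN => _ h /h[]. Qed.

Lemma normal_w x : U x -> ip J (N x) w = 0.
Proof. by case: hN => _ h /h[]. Qed.

Lemma normal_tangent x X : U x -> ip J (N x) ('D_X F x) = 0.
Proof. by case: hN => _ h /h[]. Qed.

Lemma surface_frameP x : U x ->
  surface_frame J (E x) c (F x) (Fu x) (Fv x) (N x) w.
Proof.
move=> Ux; have C a b (e : R) : ip J a b = e -> ip J b a = e.
  by rewrite (ipC J Jsym b).
have I X Y := hI x Ux X Y.
split.
- exact: lift_null.
- exact/C/tangent_lift.
- exact/C/tangent_lift.
- exact/C/normal_lift.
- exact: lift_w.
- by apply: (etrans (I _ _)); rewrite /= mulr0 addr0 !mulr1.
- by apply: (etrans (I _ _)); rewrite /= mulr0 mul0r addr0 mulr0.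
- exact/C/normal_tangent.
- exact: tangent_w.
- by apply: (etrans (I _ _)); rewrite /= mulr0 add0r !mulr1.
- exact/C/normal_tangent.
- exact: tangent_w.
- exact: normal_normal.
- exact: normal_w.
- by [].
Qed.

Lemma gauss_formulas x : U x ->
  [/\ 'D_e_u Fu x = 'D_e_u theta x *: Fu x - 'D_e_v theta x *: Fv x
        + (E x * k1 x) *: N x + E x *: (w + c *: F x),
      'D_e_v Fu x = 'D_e_v theta x *: Fu x + 'D_e_u theta x *: Fv x,
      'D_e_u Fv x = 'D_e_v theta x *: Fu x + 'D_e_u theta x *: Fv x
    & 'D_e_v Fv x = - 'D_e_u theta x *: Fu x + 'D_e_v theta x *: Fv x
        + (E x * k2 x) *: N x + E x *: (w + c *: F x)].
Proof.
move=> Ux; have fr := surface_frameP x Ux.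
have sw X Y := second_derivative_w x X Y Ux.
have sf X Y := second_derivative_lift x X Y Ux.
have sn X Y := hII x Ux X Y.
have st X Y Z := second_derivative_tangent x X Y Z Ux.
have sC := smooth_mx_deriveC oU e_u e_v sF Ux.
have [] := second_derivatives _ Jsym _ _ _ _ _ _ _ ('D_e_u theta x)
  ('D_e_v theta x) (k1 x) (k2 x) ('D_e_u Fu x) ('D_e_u Fv x) ('D_e_v Fu x)
  ('D_e_v Fv x) (conformal_factor_neq0 x) fr sC
  (sf _ _) (sf _ _) (sf _ _) (sw _ _) (sw _ _) (sw _ _).
- by apply: (etrans (sn _ _)); rewrite /= !(mulr0, mulr1, addr0).
- by apply: (etrans (sn _ _)); rewrite /= !(mulr0, mul0r, mulr1, addr0).
- by apply: (etrans (sn _ _)); rewrite /= !(mulr0, mul0r, mulr1, add0r).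
- by apply: (etrans (st _ _ _)); rewrite /= !(mulr0, mul1r, addr0).
- by apply: (etrans (st _ _ _)); rewrite /= !(mulr0, mul1r, addr0).
- by apply: (etrans (st _ _ _)); rewrite /= !(mulr0, mul1r, add0r).
- by apply: (etrans (st _ _ _)); rewrite /= !(mulr0, mul1r, add0r).
- by apply: (etrans (st _ _ _)); rewrite /= !(mulr0, mul0r, addr0).
- by apply: (etrans (st _ _ _)); rewrite /= !(mulr0, mul0r, addr0).
move=> Euu Euv Evv; split;
  [exact: Euu|exact: (etrans (esym sC) Euv)|exact: Euv|exact: Evv].
Qed.

Lemma weingarten x : U x ->
  'D_e_u N x = - k1 x *: Fu x /\ 'D_e_v N x = - k2 x *: Fv x.
Proof.
move=> Ux; have fr := surface_frameP x Ux.
have nn X := derive_ip_cst X sN sN Ux normal_normal.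
have nf X := derive_ip_cst X sN sF Ux normal_lift.
have nw X : ip J ('D_X N x) w = 0.
  have := derive_ip_cst X sN (scst w) Ux normal_w.
  by rewrite derive_cst_vec ip0r addr0.
have nt X Y := derive_ip_cst X sN (sD Y) Ux (fun y => normal_tangent y Y).
have sn X Y : ip J (N x) ('D_X ('D_Y F) x) =
    E x * (k1 x * (X.1 * Y.1) + k2 x * (X.2 * Y.2)).
  by rewrite (ipC J Jsym (N x)); exact: hII.
have shape X : 'D_X N x = (- k1 x * X.1) *: Fu x + (- k2 x * X.2) *: Fv x.
  apply: (shape_operator _ Jsym _ _ _ _ _ _ _ _ _ _ _
    (conformal_factor_neq0 x) fr _ (nf X) (nn X) (nw X)).
  - exact: normal_tangent.
  - apply: (addr_eq0_opp _ _ _ (nt X e_u)); apply: (etrans (sn _ _)).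
    by rewrite /= !(mulr0, mulr1, addr0); ring.
  - apply: (addr_eq0_opp _ _ _ (nt X e_v)); apply: (etrans (sn _ _)).
    by rewrite /= !(mulr0, mulr1, add0r); ring.
split; apply: (etrans (shape _)); rewrite /=.
  by rewrite mulr0 scale0r addr0 mulr1.
by rewrite mulr0 scale0r add0r mulr1.
Qed.

Lemma codazzi x : U x ->
  'D_e_v k1 x = 'D_e_v theta x * (k2 x - k1 x) /\
  'D_e_u k2 x = 'D_e_u theta x * (k1 x - k2 x).
Proof.
move=> Ux; have fr y Uy := surface_frameP y Uy.
have [Euu Evu Euv Evv] := gauss_formulas x Ux.
have [Wu Wv] := weingarten x Ux.
have sDN X : smooth U ('D_X N) by exact: smooth_derive.
have ipl a a' b (e : R) : a = a' -> ip J a' b = e -> ip J a b = e by move=> ->.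
have dkE (k : plane R -> R^o) X : smooth U k -> is_derive x X
    (fun y => - k y * E y : R^o)
    (- k x * (E x * (2 * 'D_X theta x)) + E x * - 'D_X k x).
  move=> sk; apply: is_deriveMf; last exact: is_derive_conformal_factor.
  exact/is_deriveN/smooth_is_derive.
have uu := derive_ip_on (sDN e_u) (sD e_u) Ux _ (dkE k1 e_v sk1).
have uv : ip J ('D_e_v ('D_e_u N) x) (Fv x)
    + ip J ('D_e_u N x) ('D_e_v Fv x) = 0.
  apply: (derive_ip_cst (a := 0)) => // y Uy.
  apply: (ipl _ _ _ _ (weingarten y Uy).1).
  by rewrite ipZl (frame_ab _ _ _ _ _ _ _ _ (fr y Uy)) mulr0.
have vu : ip J ('D_e_u ('D_e_v N) x) (Fu x)
    + ip J ('D_e_v N x) ('D_e_u Fu x) = 0.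
  apply: (derive_ip_cst (a := 0)) => // y Uy.
  apply: (ipl _ _ _ _ (weingarten y Uy).2).
  by rewrite ipZl (ipC J Jsym) (frame_ab _ _ _ _ _ _ _ _ (fr y Uy)) mulr0.
have vv := derive_ip_on (sDN e_v) (sD e_v) Ux _ (dkE k2 e_u sk2).
have NC := smooth_mx_deriveC oU e_v e_u sN Ux.
apply: (codazzi_of_normal J Jsym (E x) c (F x) (Fu x) (Fv x) (N x) w
  ('D_e_u theta x) ('D_e_v theta x) (k1 x) (k2 x) ('D_e_v k1 x) ('D_e_u k2 x)
  _ _ _ _ _ _ _ _ (conformal_factor_neq0 x) (fr x Ux) NC Wu Wv Euu Evu Euv Evv
  (uu _) uv vu (vv _)) => y Uy.
- apply: (ipl _ _ _ _ (weingarten y Uy).1).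
  by rewrite ipZl (frame_aa _ _ _ _ _ _ _ _ (fr y Uy)).
- apply: (ipl _ _ _ _ (weingarten y Uy).2).
  by rewrite ipZl (frame_bb _ _ _ _ _ _ _ _ (fr y Uy)).
Qed.

Definition mean_curvature x : R^o := (k1 x + k2 x) / 2.

(** Four times the coefficient of the Hopf differential. *)
Definition skew_curvature x : R^o := E x * (k1 x - k2 x).
Local Notation H := mean_curvature.
Local Notation L := skew_curvature.

Lemma smooth_mean_curvature : smooth U H.
Proof.
by apply: smoothM => //; [exact: smoothD|exact: smooth_cst].
Qed.

Lemma smooth_skew_curvature : smooth U L.
Proof.
by apply: smoothM => //; [exact: smooth_conformal_factor|exact: smoothB].
Qed.

Lemma derive_mean_curvature x X : U x ->
  'D_X H x = ('D_X k1 x + 'D_X k2 x) / 2.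
Proof.
move=> Ux.
have d : is_derive x X (fun y => k1 y + k2 y : R^o) ('D_X k1 x + 'D_X k2 x).
  by apply: is_deriveD; exact: smooth_is_derive.
have [_ ->] := is_deriveMf _ _ _ _ _ _ d (is_derive_cst (2^-1 : R^o) x X).
by rewrite mulr0 add0r mulrC.
Qed.

(** The Codazzi equations in terms of H and L. *)
Lemma is_derive_skew_curvature x : U x ->
  is_derive x e_u L (2 * E x * 'D_e_u H x) /\
  is_derive x e_v L (- 2 * E x * 'D_e_v H x).
Proof.
move=> Ux; have [c1 c2] := codazzi x Ux.
have d X : is_derive x X L
    (E x * ('D_X k1 x - 'D_X k2 x)
      + (k1 x - k2 x) * (E x * (2 * 'D_X theta x))).
  apply: is_deriveMf; first exact: is_derive_conformal_factor.
  by apply: is_deriveB; exact: smooth_is_derive.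
have hu := derive_mean_curvature x e_u Ux.
have hv := derive_mean_curvature x e_v Ux.
split; [apply: (is_derive_eq (d e_u)) | apply: (is_derive_eq (d e_v))].
  rewrite hu; move: c2; generalize ('D_e_u k1 x) ('D_e_u k2 x) ('D_e_u theta x).
  by move=> a b t /= ->; field.
rewrite hv; move: c1; generalize ('D_e_v k1 x) ('D_e_v k2 x) ('D_e_v theta x).
by move=> a b t /= ->; field.
Qed.

(** The integrability condition of the previous two equations. *)
Lemma mean_curvature_uv x : U x ->
  'D_e_v ('D_e_u H) x =
    - ('D_e_v theta x * 'D_e_u H x + 'D_e_u theta x * 'D_e_v H x) /\
  'D_e_u ('D_e_v H) x =
    - ('D_e_v theta x * 'D_e_u H x + 'D_e_u theta x * 'D_e_v H x).
Proof.
have solve (e h h' hu hv tu tv : R) : e != 0 -> h = h' ->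
    2 * e * h + hu * (2 * (e * (2 * tv))) =
      - 2 * e * h' + hv * (- 2 * (e * (2 * tu))) ->
    h = - (tv * hu + tu * hv).
  by move=> e0 <- eq; apply: (mulfI e0); move: eq; lra.
move=> Ux; have sH := smooth_mean_curvature.
have sym := smooth_deriveC oU e_v e_u sH Ux.
suff h : 'D_e_v ('D_e_u H) x =
    - ('D_e_v theta x * 'D_e_u H x + 'D_e_u theta x * 'D_e_v H x).
  by split; [exact: h | exact: (etrans (esym sym) h)].
have LC := smooth_deriveC oU e_v e_u smooth_skew_curvature Ux.
have d (k : R) X Y : is_derive x Y (fun y => k * E y * 'D_X H y : R^o)
    (k * E x * 'D_Y ('D_X H) x + 'D_X H x * (k * (E x * (2 * 'D_Y theta x)))).
  apply: is_deriveMf.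
    have := is_deriveMf (cst k) E x Y 0 _ (is_derive_cst _ _ _)
      (is_derive_conformal_factor x Y Ux).
    by rewrite mulr0 addr0.
  exact: (smooth_is_derive Y (smooth_derive X sH) Ux).
have Lu : forall y, U y -> 2 * E y * 'D_e_u H y = 'D_e_u L y.
  by move=> y Uy; have [[_ ->] _] := is_derive_skew_curvature y Uy.
have Lv : forall y, U y -> - 2 * E y * 'D_e_v H y = 'D_e_v L y.
  by move=> y Uy; have [_ [_ ->]] := is_derive_skew_curvature y Uy.
have [_ Luv] := is_derive_on oU Ux Lu (d 2 e_u e_v).
have [_ Lvu] := is_derive_on oU Ux Lv (d (- 2) e_v e_u).
have := etrans (etrans (esym Luv) LC) Lvu.
have E0 := conformal_factor_neq0 x.
exact: (solve _ _ _ _ _ _ _ E0 sym).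
Qed.

Lemma surface_structure :
  structure_equations J U w F Fu Fv N E ('D_e_u theta) ('D_e_v theta) k1 k2 H L
    ('D_e_u H) ('D_e_v H) ('D_e_u ('D_e_u H)) ('D_e_v ('D_e_u H))
    ('D_e_v ('D_e_v H)).
Proof.
have sH := smooth_mean_curvature.
have sDH X : smooth U ('D_X H) by exact: smooth_derive.
split.
- exact: surface_frameP.
- exact: conformal_factor_neq0.
- by move=> x Ux; split; exact: smooth_is_derive.
- move=> x Ux; have [Euu Evu _ _] := gauss_formulas x Ux; split.
    exact: (is_derive_eq (smooth_is_derive e_u (sD e_u) Ux) Euu).
  exact: (is_derive_eq (smooth_is_derive e_v (sD e_u) Ux) Evu).
- move=> x Ux; have [_ _ Euv Evv] := gauss_formulas x Ux; split.
    exact: (is_derive_eq (smooth_is_derive e_u (sD e_v) Ux) Euv).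
  exact: (is_derive_eq (smooth_is_derive e_v (sD e_v) Ux) Evv).
- move=> x Ux; have [Wu Wv] := weingarten x Ux; split.
    exact: (is_derive_eq (smooth_is_derive e_u sN Ux) Wu).
  exact: (is_derive_eq (smooth_is_derive e_v sN Ux) Wv).
- by move=> x Ux; split; exact: is_derive_conformal_factor.
- by [].
- by [].
- by move=> x Ux; split; exact: smooth_is_derive.
- exact: is_derive_skew_curvature.
- by move=> x Ux; split; exact: (smooth_is_derive _ (sDH e_u) Ux).
- move=> x Ux; split; last exact: (smooth_is_derive _ (sDH e_v) Ux).
  have [vu uv] := mean_curvature_uv x Ux.
  exact: (is_derive_eq (smooth_is_derive e_u (sDH e_v) Ux)
    (etrans uv (esym vu))).
- by move=> x Ux; have [vu _] := mean_curvature_uv x Ux; exact: vu.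
- exact: sF.
- exact: sD.
- exact: sD.
- exact: sN.
- exact: sH.
- exact: smooth_skew_curvature.
- exact: sDH.
- exact: sDH.
Qed.

End SurfaceGeometry.

(** * Conserved quantities of degree two in the frame *)

Section ConservedQuantities.
Context {R : realType} (J : 'M[R]_5) (U : set (plane R)) (w : vec5 R).
Context (F Fu Fv N : plane R -> vec5 R).
Context (E tu tv k1 k2 H L Hu Hv Huu Huv Hvv : plane R -> R^o).
Local Notation c := (ip J w w).
Context (Jsym : J^T = J) (oU : open U) (cU : connected U).
Context (S : structure_equations J U w F Fu Fv N E tu tv k1 k2 H L Hu Hv
  Huu Huv Hvv).

Let fr := frameP S.         Let E0 := factor_neq0 S.    Let dF := derive_F S.
Let dFu := derive_Fu S.     Let dFv := derive_Fv S.     Let dN := derive_N S.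
Let dE := derive_E S.       Let HE := meanE S.          Let LE := skewE S.
Let dH := derive_H S.       Let dL := derive_L S.       Let dHu := derive_Hu S.
Let dHv := derive_Hv S.     Let HuvE := HuvE S.
Let sF := smooth_F S.       Let sFu := smooth_Fu S.     Let sFv := smooth_Fv S.
Let sN := smooth_N S.       Let sH := smooth_H S.       Let sL := smooth_L S.
Let sHu := smooth_Hu S.     Let sHv := smooth_Hv S.

(** The equation (d + t eta)(a w + t q1 + t^2 q2) = 0, coefficient by
    coefficient and with eta written out in the frame. *)
Definition conserved_coefficients (a : R) (q1 q2 : plane R -> vec5 R) :=
  forall x, U x -> [/\ is_derive x e_u q1 (- (a * (E x)^-1) *: Fu x),
    is_derive x e_v q1 ((a * (E x)^-1) *: Fv x),
    is_derive x e_u q2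
      ((E x)^-1 *: (ip J (F x) (q1 x) *: Fu x - ip J (Fu x) (q1 x) *: F x)),
    is_derive x e_v q2
      (- (E x)^-1 *: (ip J (F x) (q1 x) *: Fv x - ip J (Fv x) (q1 x) *: F x))
    & [/\ ip J (F x) (q2 x) = 0, ip J (Fu x) (q2 x) = 0
        & ip J (Fv x) (q2 x) = 0]].

Definition mean_curvature_equations (A B C : R) :=
  forall x, U x ->
  Huu x + tu x * Hu x - tv x * Hv x - 1 / 2 * - (H x * L x) * k1 x - A * k1 x
    - B * (E x)^-1 + C - 1 / 2 * L x * c = 0 /\
  Hvv x - tu x * Hu x + tv x * Hv x + 1 / 2 * - (H x * L x) * k2 x + A * k2 x
    - B * (E x)^-1 - C + 1 / 2 * L x * c = 0.

Lemma is_derive_ip_unique {A B : plane R -> vec5 R} {h : plane R -> R^o}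
    {x X dA dB dh} :
  U x -> (forall y, U y -> ip J (A y) (B y) = h y) ->
  is_derive x X A dA -> is_derive x X B dB -> is_derive x X h dh ->
  ip J dA (B x) + ip J (A x) dB = dh.
Proof.
move=> Ux hh dAx dBx [_ <-].
by have /(is_derive_on oU Ux hh)[_ ->] := is_derive_ip J _ _ _ _ _ _ dAx dBx.
Qed.

Lemma constant_of_is_derive {f : plane R -> R^o} : smooth U f ->
  (forall x, U x -> is_derive x e_u f 0 /\ is_derive x e_v f 0) ->
  forall x y, U x -> U y -> f x = f y.
Proof.
move=> sf df; apply: smooth_const => // x Ux.
by have [[_ du] [_ dv]] := df x Ux.
Qed.

(** The values are k1 L_u and k2 L_v. *)
Lemma is_derive_HL x : U x ->
  is_derive x e_u (fun y => H y * L y : R^o) (2 * k1 x * E x * Hu x) /\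
  is_derive x e_v (fun y => H y * L y : R^o) (- 2 * k2 x * E x * Hv x).
Proof.
move=> Ux; have [Lu Lv] := dL x Ux; have [hu hv] := dH x Ux.
split; [apply: (is_derive_eq (is_deriveMf _ _ _ _ _ _ hu Lu))
  | apply: (is_derive_eq (is_deriveMf _ _ _ _ _ _ hv Lv))].
  by rewrite HE LE /=; field.
by rewrite HE LE /=; field.
Qed.

Section Necessity.
Context (a : R) (q1 q2 : plane R -> vec5 R).
Context (sq1 : smooth U q1) (sq2 : smooth U q2).
Context (q2_neq0 : exists x, U x /\ q2 x != 0).
Context (qP : conserved_coefficients a q1 q2).

(** This inner product is the constant b.  Its derivative vanishes because dN is
    a combination of F_u and F_v, to which q2 is orthogonal, and d q2 is a
    combination of F, F_u and F_v, to which N is orthogonal. *)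
Lemma ip_normal_top_const x y : U x -> U y ->
  ip J (N x) (q2 x) = ip J (N y) (q2 y).
Proof.
apply: (constant_of_is_derive (smooth_ip oU J sN sq2)) => z Uz.
have [_ _ q2u q2v [f0 a0 b0]] := qP z Uz; have [Nu Nv] := dN z Uz.
have [ff fa fb fn fw aa ab an aw bb bn bw nn nw ww] := fr z Uz.
split; [apply: (is_derive_eq (is_derive_ip J _ _ _ _ _ _ Nu q2u))
  | apply: (is_derive_eq (is_derive_ip J _ _ _ _ _ _ Nv q2v))].
  rewrite !ip_lin a0 (ipC J Jsym (N z) (Fu z)) an (ipC J Jsym (N z) (F z)) fn.
  ring.
rewrite !ip_lin b0 (ipC J Jsym (N z) (Fv z)) bn (ipC J Jsym (N z) (F z)) fn.
ring.
Qed.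

(** Differentiate (F_u,q2) = 0 along u and (F_v,q2) = 0 along v: the results are
    two linear equations for (w,q2) and (F,q1). *)
Lemma top_lift_coefficients x : U x ->
  ip J w (q2 x) = - (ip J (N x) (q2 x) * H x) /\
  ip J (F x) (q1 x) = - (ip J (N x) (q2 x) / 2 * L x).
Proof.
have solve (e k l b g f t1 t2 d p q : R) : e != 0 ->
    t1 * 0 - t2 * 0 + e * k * b + e * (g + d * 0)
      + e^-1 * (f * e - p * 0) = 0 ->
    - t1 * 0 + t2 * 0 + e * l * b + e * (g + d * 0)
      + - e^-1 * (f * e - q * 0) = 0 ->
    g = - (b * ((k + l) / 2)) /\ f = - (b / 2 * (e * (k - l))).
  move=> e0; rewrite !(mulr0, subr0, mulNr) (mulrC f) !mulKf// => eu ev.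
  by split; [apply: (mulfI e0)|]; lra.
move=> Ux; have [_ _ q2u q2v [f0 a0 b0]] := qP x Ux.
have [Fuu _] := dFu x Ux; have [_ Fvv] := dFv x Ux.
have [ff fa fb fn fw aa ab an aw bb bn bw nn nw ww] := fr x Ux.
have zero X : is_derive x X (cst 0 : plane R -> R^o) 0.
  exact: is_derive_cst.
have a0' y (Uy : U y) : ip J (Fu y) (q2 y) = cst 0 y.
  by have [_ _ _ _ []] := qP y Uy.
have b0' y (Uy : U y) : ip J (Fv y) (q2 y) = cst 0 y.
  by have [_ _ _ _ []] := qP y Uy.
have := is_derive_ip_unique Ux b0' Fvv q2v (zero _).
have := is_derive_ip_unique Ux a0' Fuu q2u (zero _).
rewrite !ip_lin f0 a0 b0 aa bb (ipC J Jsym (Fu x) (F x)) fa.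
rewrite (ipC J Jsym (Fv x) (F x)) fb HE LE.
exact: (solve _ _ _ _ _ _ _ _ _ _ _ (E0 x)).
Qed.

(** Differentiate (w,q2) = - b H. *)
Lemma middle_tangent_coefficients x : U x ->
  ip J (Fu x) (q1 x) = - (ip J (N x) (q2 x) * (E x * Hu x)) /\
  ip J (Fv x) (q1 x) = ip J (N x) (q2 x) * (E x * Hv x).
Proof.
have solve (e p q b h : R) : e != 0 ->
    e^-1 * (p * 0 - q * -1) = - (b * h) -> q = - (b * (e * h)).
  move=> e0 eq; apply: (mulfI (invr_neq0 e0)).
  by rewrite mulrN mulrCA mulKf// -eq; ring.
have solve' (e p q b h : R) : e != 0 ->
    - e^-1 * (p * 0 - q * -1) = - (b * h) -> q = b * (e * h).
  move=> e0 eq; apply: (mulfI (invr_neq0 e0)).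
  by rewrite mulrCA mulKf// -[RHS]opprK -eq; ring.
move=> Ux; have [_ _ q2u q2v [f0 a0 b0]] := qP x Ux.
have [Hux Hvx] := dH x Ux; set b := ip J (N x) (q2 x).
have [ff fa fb fn fw aa ab an aw bb bn bw nn nw ww] := fr x Ux.
have zero X : is_derive x X (cst w : plane R -> vec5 R) 0.
  exact: is_derive_cst.
have g y : U y -> ip J (cst w y) (q2 y) = - (b * H y).
  move=> Uy; rewrite /b (ip_normal_top_const x y Ux Uy).
  by have [-> _] := top_lift_coefficients y Uy.
have dbH X h : is_derive x X H h ->
    is_derive x X (fun y => - (b * H y) : R^o) (- (b * h)).
  by move=> dh; apply: is_deriveN; exact: is_derive_cstM.
have := is_derive_ip_unique Ux g (zero _) q2v (dbH _ _ Hvx).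
have := is_derive_ip_unique Ux g (zero _) q2u (dbH _ _ Hux).
rewrite /cst !ip_lin (ipC J Jsym w (F x)) fw (ipC J Jsym w (Fu x)) aw.
rewrite (ipC J Jsym w (Fv x)) bw !add0r => eu ev; split.
  exact: (solve _ _ _ _ _ (E0 x) eu).
exact: (solve' _ _ _ _ _ (E0 x) ev).
Qed.

Lemma middle_w_const x y : U x -> U y -> ip J w (q1 x) = ip J w (q1 y).
Proof.
apply: (constant_of_is_derive (f := fun y => ip J w (q1 y))) => [|z Uz].
  exact: (smooth_ip oU J (smooth_cst oU w) sq1).
have [q1u q1v _ _ _] := qP z Uz.
have [ff fa fb fn fw aa ab an aw bb bn bw nn nw ww] := fr z Uz.
have zero X : is_derive z X (cst w : plane R -> vec5 R) 0.
  exact: is_derive_cst.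
split; [apply: (is_derive_eq (is_derive_ip J _ _ _ _ _ _ (zero e_u) q1u))
  | apply: (is_derive_eq (is_derive_ip J _ _ _ _ _ _ (zero e_v) q1v))].
  by rewrite !ip_lin (ipC J Jsym w (Fu z)) aw mulr0 addr0.
by rewrite !ip_lin (ipC J Jsym w (Fv z)) bw mulr0 addr0.
Qed.

(** The derivative of (N,q1) is - k1 (F_u,q1) along u and - k2 (F_v,q1) along v,
    which is the derivative of b H L / 2 by is_derive_HL. *)
Lemma middle_normal_const x y : U x -> U y ->
  ip J (N x) (q1 x) - ip J (N x) (q2 x) / 2 * (H x * L x) =
  ip J (N y) (q1 y) - ip J (N y) (q2 y) / 2 * (H y * L y).
Proof.
move=> Ux Uy; rewrite (ip_normal_top_const y x Uy Ux).
set b := ip J (N x) (q2 x).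
pose m : plane R -> R^o := fun z => ip J (N z) (q1 z) - b / 2 * (H z * L z).
suff : m x = m y by [].
apply: (constant_of_is_derive (f := m)) => // [|z Uz].
  apply: (smoothB oU); first exact: (smooth_ip oU J sN sq1).
  by apply: (smoothM oU); [exact: smooth_cst|exact: (smoothM oU)].
have [q1u q1v _ _ _] := qP z Uz; have [Nu Nv] := dN z Uz.
have [HLu HLv] := is_derive_HL z Uz.
have [ff fa fb fn fw aa ab an aw bb bn bw nn nw ww] := fr z Uz.
have [au bv] := middle_tangent_coefficients z Uz.
rewrite (ip_normal_top_const z x Uz Ux) -/b in au bv.
have dbHL X h : is_derive z X (fun y => H y * L y : R^o) h ->
    is_derive z X (fun y => b / 2 * (H y * L y) : R^o) (b / 2 * h).
  exact: is_derive_cstM.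
split; [apply: (is_derive_eq (is_deriveB
    (is_derive_ip J _ _ _ _ _ _ Nu q1u) (dbHL _ _ HLu)))
  | apply: (is_derive_eq (is_deriveB
    (is_derive_ip J _ _ _ _ _ _ Nv q1v) (dbHL _ _ HLv)))].
  by rewrite !ip_lin au (ipC J Jsym (N z) (Fu z)) an; field.
by rewrite !ip_lin bv (ipC J Jsym (N z) (Fv z)) bn; field.
Qed.

Lemma top_normal_neq0 x : U x -> ip J (N x) (q2 x) != 0.
Proof.
move=> Ux; have [y [Uy]] := q2_neq0; apply: contra_neq.
rewrite -(ip_normal_top_const y x Uy Ux) => b0.
have [_ _ _ _ [f0 a0 b1]] := qP y Uy.
have [] := top_lift_coefficients y Uy; rewrite b0 mul0r oppr0 => g0 _.
apply: (frame_ext J Jsym _ _ _ _ _ _ _ _ _ (E0 y) (fr y Uy));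
  by rewrite ip0r.
Qed.

(** Differentiate (F_u,q1) = - b E H_u along u and (F_v,q1) = b E H_v along v,
    where all inner products of q1 with the frame are known. *)
Lemma mean_curvature_equations_of_conserved :
  exists A B C, mean_curvature_equations A B C.
Proof.
have solve_u (e b m s a' d h t1 t2 hu hv huu l k : R) : b != 0 -> e != 0 ->
    t1 * - (b * (e * hu)) - t2 * (b * (e * hv)) + e * k * (m + b / 2 * (h * l))
      + e * (s + d * - (b / 2 * l)) + - (a' / e) * e
      = - b * (e * huu + hu * (e * (2 * t1))) ->
    huu + t1 * hu - t2 * hv - 1 / 2 * - (h * l) * k - - m / b * k - a' / b / e
      + s / b - 1 / 2 * l * d = 0.
  move=> b0 e0 /eqP; rewrite -subr_eq0 => /eqP eq.
  apply: (mulfI (mulf_neq0 b0 e0)); rewrite mulr0 -{}eq; field.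
  by rewrite b0 e0.
have solve_v (e b m s a' d h t1 t2 hu hv hvv l k : R) : b != 0 -> e != 0 ->
    - t1 * - (b * (e * hu)) + t2 * (b * (e * hv))
      + e * k * (m + b / 2 * (h * l)) + e * (s + d * - (b / 2 * l)) + a' / e * e
      = b * (e * hvv + hv * (e * (2 * t2))) ->
    hvv - t1 * hu + t2 * hv + 1 / 2 * - (h * l) * k + - m / b * k - a' / b / e
      - s / b + 1 / 2 * l * d = 0.
  move=> b0 e0 /eqP; rewrite eq_sym -subr_eq0 => /eqP eq.
  apply: (mulfI (mulf_neq0 b0 e0)); rewrite mulr0 -{}eq; field.
  by rewrite b0 e0.
have [x0 [Ux0 _]] := q2_neq0.
set b := ip J (N x0) (q2 x0); have b0 : b != 0 by exact: top_normal_neq0.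
set m := ip J (N x0) (q1 x0) - b / 2 * (H x0 * L x0).
set s := ip J w (q1 x0).
exists (- m / b), (a / b), (s / b) => x Ux.
have bE := ip_normal_top_const x x0 Ux Ux0; rewrite -/b in bE.
have [_ fq] := top_lift_coefficients x Ux.
have [aq bq] := middle_tangent_coefficients x Ux.
have wq := middle_w_const x x0 Ux Ux0; rewrite -/s in wq.
have nq := middle_normal_const x x0 Ux Ux0; rewrite bE -/b -/m in nq.
rewrite bE in fq aq bq.
have nqE : ip J (N x) (q1 x) = m + b / 2 * (H x * L x).
  by rewrite -nq subrK.
have [q1u q1v _ _ _] := qP x Ux.
have [Fuu _] := dFu x Ux; have [_ Fvv] := dFv x Ux.
have [Huu' _] := dHu x Ux; have [_ Hvv'] := dHv x Ux.
have [Eu Ev] := dE x Ux.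
have [ff fa fb fn fw aa ab an aw bb bn bw nn nw ww] := fr x Ux.
have au y : U y -> ip J (Fu y) (q1 y) = - b * (E y * Hu y).
  move=> Uy; rewrite mulNr /b -(ip_normal_top_const y x0 Uy Ux0).
  by have [-> _] := middle_tangent_coefficients y Uy.
have bv y : U y -> ip J (Fv y) (q1 y) = b * (E y * Hv y).
  move=> Uy; rewrite /b -(ip_normal_top_const y x0 Uy Ux0).
  by have [_ ->] := middle_tangent_coefficients y Uy.
have := is_derive_ip_unique Ux bv Fvv q1v
  (is_derive_cstM b _ _ _ _ (is_deriveMf _ _ _ _ _ _ Ev Hvv')).
have := is_derive_ip_unique Ux au Fuu q1u
  (is_derive_cstM (- b) _ _ _ _ (is_deriveMf _ _ _ _ _ _ Eu Huu')).
rewrite !ip_lin fq aq bq wq nqE aa bb.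
move=> eu ev; split.
  exact: (solve_u _ _ _ _ _ _ _ _ _ _ _ _ _ _ b0 (E0 x) eu).
exact: (solve_v _ _ _ _ _ _ _ _ _ _ _ _ _ _ b0 (E0 x) ev).
Qed.

End Necessity.

Section Sufficiency.
Context (A B C : R) (eqs : mean_curvature_equations A B C).

(** The section with the inner products with the frame that were found above for
    q1, when b = 1 and so m = - A and s = C. *)
Definition middle_coefficient x : vec5 R :=
  (1 / 2 * c * L x - C) *: F x + (- Hu x) *: Fu x + Hv x *: Fv x
  + (1 / 2 * (H x * L x) - A) *: N x + (1 / 2 * L x) *: w.

Definition top_coefficient x : vec5 R := H x *: F x + N x.

Lemma smooth_middle_coefficient : smooth U middle_coefficient.
Proof.
have sk (k : R) (f : plane R -> R^o) : smooth U f ->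
    smooth U (fun x => k * f x : R^o).
  by move=> sf; apply: (smoothM oU) => //; exact: (smooth_cst oU).
have sB (k : R) (f : plane R -> R^o) : smooth U f ->
    smooth U (fun x => f x - k : R^o).
  by move=> sf; apply: (smoothB oU) => //; exact: (smooth_cst oU).
apply: (smoothD oU); last first.
  by apply: (smoothZ oU); [exact: sk|exact: (smooth_cst oU)].
apply: (smoothD oU); last first.
  apply: (smoothZ oU) => //; apply: sB; apply: sk; exact: (smoothM oU).
apply: (smoothD oU); last exact: (smoothZ oU).
apply: (smoothD oU); apply: (smoothZ oU) => //; last exact: (smoothN oU).
by apply: sB; apply: sk.
Qed.

Lemma smooth_top_coefficient : smooth U top_coefficient.
Proof. by apply: (smoothD oU) => //; exact: (smoothZ oU). Qed.

Lemma top_coefficient_neq0 x : U x -> top_coefficient x != 0.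
Proof.
move=> Ux; apply/eqP => q0.
have [ff fa fb fn fw aa ab an aw bb bn bw nn nw ww] := fr x Ux.
have : ip J (N x) (top_coefficient x) = 1.
  by rewrite /top_coefficient !ip_lin nn (ipC J Jsym (N x)) fn mulr0 add0r.
by rewrite q0 ip0r => /eqP; rewrite eq_sym oner_eq0.
Qed.

(** In the derivative of q1 along u the components along F, N and w cancel by
    the formulas for L_u and (H L)_u, the one along F_v by the formula for H_uv,
    and the first mean curvature equation says that the one along F_u is
    - B / E.  The derivative along v is analogous. *)
Lemma conserved_of_mean_curvature_equations :
  conserved_coefficients B middle_coefficient top_coefficient.
Proof.
move=> x Ux; have [eu ev] := eqs x Ux.
have [ff fa fb fn fw aa ab an aw bb bn bw nn nw ww] := fr x Ux.
have [Fu' Fv'] := dF x Ux; have [Fuu Fuv] := dFu x Ux.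
have [Fvu Fvv] := dFv x Ux; have [Nu Nv] := dN x Ux.
have [Hu' Hv'] := dH x Ux; have [Huu' Huv'] := dHu x Ux.
have [Hvu' Hvv'] := dHv x Ux; have [Lu Lv] := dL x Ux.
have [HLu HLv] := is_derive_HL x Ux.
have dB (k : R) X (f : plane R -> R^o) df : is_derive x X f df ->
    is_derive x X (fun y => f y - k : R^o) df.
  move=> dfx.
  apply: (is_derive_eq (is_deriveB dfx (is_derive_cst (k : R^o) x X))).
  exact: subr0.
have dq1 X dFx dFux dFvx dNx (dLx dHux dHvx dHLx : R) :
    is_derive x X F dFx -> is_derive x X Fu dFux -> is_derive x X Fv dFvx ->
    is_derive x X N dNx -> is_derive x X L dLx -> is_derive x X Hu dHux ->
    is_derive x X Hv dHvx -> is_derive x X (fun y => H y * L y : R^o) dHLx ->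
    is_derive x X middle_coefficient
      (((1 / 2 * c * L x - C) *: dFx + (1 / 2 * c * dLx) *: F x)
      + ((- Hu x) *: dFux + (- dHux) *: Fu x) + (Hv x *: dFvx + dHvx *: Fv x)
      + ((1 / 2 * (H x * L x) - A) *: dNx + (1 / 2 * dHLx) *: N x)
      + ((1 / 2 * L x) *: 0 + (1 / 2 * dLx) *: w)).
  move=> f fu fv n l hu hv hl.
  apply: is_deriveD; last first.
    exact: is_deriveZf (is_derive_cstM _ _ _ _ _ l) (is_derive_cst w x X).
  apply: is_deriveD; last first.
    exact: is_deriveZf (dB _ _ _ _ (is_derive_cstM _ _ _ _ _ hl)) n.
  apply: is_deriveD; last exact: is_deriveZf.
  apply: is_deriveD; last exact: is_deriveZf (is_deriveN hu) fu.
  exact: is_deriveZf (dB _ _ _ _ (is_derive_cstM _ _ _ _ _ l)) f.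
have dq2 X dFx dNx (dHx : R) : is_derive x X F dFx -> is_derive x X N dNx ->
    is_derive x X H dHx -> is_derive x X top_coefficient
      (H x *: dFx + dHx *: F x + dNx).
  by move=> f n h; apply: is_deriveD => //; exact: is_deriveZf.
have q1f : ip J (F x) (middle_coefficient x) = - (1 / 2 * L x).
  by rewrite /middle_coefficient !ip_lin ff fa fb fn fw; ring.
have q1a : ip J (Fu x) (middle_coefficient x) = - (E x * Hu x).
  rewrite /middle_coefficient !ip_lin (ipC J Jsym (Fu x) (F x)) fa aa ab an aw.
  by ring.
have q1b : ip J (Fv x) (middle_coefficient x) = E x * Hv x.
  rewrite /middle_coefficient !ip_lin (ipC J Jsym (Fv x) (F x)) fb.
  by rewrite (ipC J Jsym (Fv x) (Fu x)) ab bb bn bw; ring.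
have e0 := E0 x.
split.
- apply: (is_derive_eq (dq1 _ _ _ _ _ _ _ _ _ Fu' Fuu Fvu Nu Lu Huu' Hvu' HLu)).
  have {}eu : Huu x = - (tu x * Hu x) + tv x * Hv x - 1 / 2 * (H x * L x) * k1 x
      + A * k1 x + B * (E x)^-1 - C + 1 / 2 * L x * c by lra.
  rewrite eu HuvE//; apply/colP => i; rewrite !mxE; field.
  by [].
- apply: (is_derive_eq (dq1 _ _ _ _ _ _ _ _ _ Fv' Fuv Fvv Nv Lv Huv' Hvv' HLv)).
  have {}ev : Hvv x = tu x * Hu x - tv x * Hv x + 1 / 2 * (H x * L x) * k2 x
      - A * k2 x + B * (E x)^-1 + C - 1 / 2 * L x * c by lra.
  rewrite ev HuvE//; apply/colP => i; rewrite !mxE; field.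
  by [].
- apply: (is_derive_eq (dq2 _ _ _ _ Fu' Nu Hu')).
  rewrite q1f q1a LE HE; apply/colP => i; rewrite !mxE; field.
  by [].
- apply: (is_derive_eq (dq2 _ _ _ _ Fv' Nv Hv')).
  rewrite q1f q1b LE HE; apply/colP => i; rewrite !mxE; field.
  by [].
- rewrite /top_coefficient !ip_lin ff fn (ipC J Jsym (Fu x) (F x)) fa an.
  by rewrite (ipC J Jsym (Fv x) (F x)) fb bn !mulr0 !addr0.
Qed.

End Sufficiency.
End ConservedQuantities.

(** * Special isothermic surfaces of type two *)

Section Coefficients.
Context {R : realType} (U : set (plane R)).
Context (eta : plane R -> {linear plane R -> 'M[R]_5}).

(** Four values of t determine the coefficients. *)
Lemma cubic_eq0 (c0 c1 c2 c3 : vec5 R) :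
  (forall t : R, c0 + t *: c1 + t ^+ 2 *: c2 + t ^+ 3 *: c3 = 0) ->
  [/\ c0 = 0, c1 = 0, c2 = 0 & c3 = 0].
Proof.
move=> h.
have hi i (t : R) :
    c0 i 0 + t * c1 i 0 + t ^+ 2 * c2 i 0 + t ^+ 3 * c3 i 0 = 0.
  by have /colP/(_ i) := h t; rewrite !mxE.
have hall i : [/\ c0 i 0 = 0, c1 i 0 = 0, c2 i 0 = 0 & c3 i 0 = 0].
  have := hi i (- 1); have := hi i 2; have := hi i 1; have := hi i 0.
  by move=> h0 h1 h2 h3; split; lra.
by split; apply/colP => i; rewrite mxE; have [] := hall i.
Qed.

Lemma peval2_sum (f : nat -> vec5 R) (t : R) :
  \sum_(k < 3) t ^+ k *: f k = f 0%N + t *: f 1%N + t ^+ 2 *: f 2%N.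
Proof. by rewrite !big_ord_recl big_ord0 /= addr0 scale1r addrA. Qed.

Lemma derive_peval2 (p : nat -> plane R -> vec5 R) (t : R) x X :
  (forall k, (k <= 2)%N -> smooth U (p k)) -> U x ->
  'D_X (peval 2 p t) x =
    'D_X (p 0%N) x + t *: 'D_X (p 1%N) x + t ^+ 2 *: 'D_X (p 2%N) x.
Proof.
move=> sp Ux.
have d : is_derive x X (peval 2 p t) (\sum_(k < 3) t ^+ k *: 'D_X (p k) x).
  apply: is_derive_sumf => k; apply: is_deriveZ.
  by apply: (smooth_is_derive X _ Ux); apply: sp; case: k.
by have [_ e] := d; exact: (etrans e (peval2_sum (fun k => 'D_X (p k) x) t)).
Qed.

(** The left-hand side is a cubic polynomial in t, which vanishes for all t
    only if its four coefficients do. *)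
Lemma conserved_quantity_coefficients (p : nat -> plane R -> vec5 R) :
  (forall k, (k <= 2)%N -> smooth U (p k)) ->
  (forall (t : R) x X, U x ->
     'D_X (peval 2 p t) x + t *: (eta x X *m peval 2 p t x) = 0) <->
  (forall x X, U x ->
     [/\ 'D_X (p 0%N) x = 0, 'D_X (p 1%N) x + eta x X *m p 0%N x = 0,
         'D_X (p 2%N) x + eta x X *m p 1%N x = 0 & eta x X *m p 2%N x = 0]).
Proof.
move=> sp.
have E (t : R) x X : U x ->
    'D_X (peval 2 p t) x + t *: (eta x X *m peval 2 p t x) =
    'D_X (p 0%N) x + t *: ('D_X (p 1%N) x + eta x X *m p 0%N x)
    + t ^+ 2 *: ('D_X (p 2%N) x + eta x X *m p 1%N x)
    + t ^+ 3 *: (eta x X *m p 2%N x).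
  move=> Ux.
  have -> : peval 2 p t x = p 0%N x + t *: p 1%N x + t ^+ 2 *: p 2%N x.
    exact: (peval2_sum (fun k => p k x) t).
  apply: (etrans (congr1 (+%R^~ _) (derive_peval2 p t x X sp Ux))).
  rewrite !mulmxDr -!scalemxAr.
  move: ('D_X (p 0%N) x) ('D_X (p 1%N) x) ('D_X (p 2%N) x) => d0 d1 d2.
  move: (eta x X *m p 0%N x) (eta x X *m p 1%N x) (eta x X *m p 2%N x).
  by move=> e0 e1 e2; apply/colP => i; rewrite !mxE; ring.
split=> h; last first.
  move=> t x X Ux; have [h0 h1 h2 h3] := h x X Ux.
  by rewrite E// h0 h1 h2 h3 !scaler0 !addr0.
move=> x X Ux; apply: cubic_eq0 => t.
by have := h t x X Ux; rewrite E.
Qed.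

End Coefficients.

Section SpecialIsothermic.
Context {R : realType} (J : 'M[R]_5) (U : set (plane R)).
Context (Lam : plane R -> {vspace vec5 R}).
Context (eta : plane R -> {linear plane R -> 'M[R]_5}) (w : vec5 R).
Context (F N : plane R -> vec5 R) (theta k1 k2 : plane R -> R^o).
Context (Jsym : J^T = J) (oU : open U) (cU : connected U).
Context (hF : is_lift U Lam F) (hFw : forall x, U x -> space_form J w (F x)).
Context (hcorr : coordinates_correspond J U Lam eta).
Context (htheta : smooth U theta) (hk1 : smooth U k1) (hk2 : smooth U k2).
Context (hI : conformal J U F theta) (hN : unit_normal J U w F N).
Context (hII : second_form J U F N theta k1 k2).

Local Notation Fu := ('D_e_u F).
Local Notation Fv := ('D_e_v F).
Local Notation E := (conformal_factor theta).
Local Notation H := (mean_curvature k1 k2).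

Let sF : smooth U F. Proof. by case: hF. Qed.
Let S := surface_structure J U w F N theta k1 k2 Jsym oU sF hFw htheta hk1 hk2
  hI hN hII.

Lemma inv_conformal_factor x : expR (- 2 * theta x) = (E x)^-1.
Proof. by rewrite mulNr expRN. Qed.

Lemma isothermic_formE x : U x ->
  (forall y, eta x e_u *m y =
    - ((E x)^-1 *: (ip J (F x) y *: Fu x - ip J (Fu x) y *: F x))) /\
  (forall y, eta x e_v *m y =
    (E x)^-1 *: (ip J (F x) y *: Fv x - ip J (Fv x) y *: F x)).
Proof.
move=> Ux; have e X := hcorr F theta hF htheta hI x Ux X.
move: (e e_u) (e e_v) (inv_conformal_factor x).
move: (Fu x) (Fv x) (F x) (eta x e_u) (eta x e_v) (expR _).
move=> a b f mu mv k -> -> ->; split=> y.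
  rewrite -scalemxAl wedgeE /= scale1r scale0r addr0 ipNl.
  by apply/colP => i; rewrite !mxE; ring.
by rewrite -scalemxAl wedgeE /= scale1r scale0r oppr0 add0r.
Qed.

Lemma isothermic_form_linear x X (y : vec5 R) :
  eta x X *m y = X.1 *: (eta x e_u *m y) + X.2 *: (eta x e_v *m y).
Proof.
have -> : eta x X = X.1 *: eta x e_u + X.2 *: eta x e_v.
  by rewrite {1}(plane_basis X) linearD !linearZ.
by rewrite mulmxDl -!scalemxAl.
Qed.

Lemma constant_coefficient (p : plane R -> vec5 R) : smooth U p ->
  (forall x X, U x -> 'D_X p x = 0) ->
  forall x y, U x -> U y -> p x = p y.
Proof.
move=> sp dp x y Ux Uy; apply/colP => i.
apply: (smooth_const oU (f := fun z => p z i 0)) => // [|z Uz].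
  exact: (smooth_mx oU i 0 sp).
have e X := etrans (esym (smooth_mx_derive X i 0 sp Uz))
  (etrans (congr1 (fun m : vec5 R => m i 0) (dp z X Uz)) (mxE _ _ _ _)).
by split; exact: e.
Qed.

Lemma special_isothermic_equations : (exists x, U x) ->
  (exists p, conserved_quantity U eta 2 p /\
    forall x, U x -> p 0%N x \in <[w]>%VS) <->
  exists A B C, mean_curvature_equations J U w E ('D_e_u theta) ('D_e_v theta)
    k1 k2 H (skew_curvature theta k1 k2) ('D_e_u H) ('D_e_v H)
    ('D_e_u ('D_e_u H)) ('D_e_v ('D_e_v H)) A B C.
Proof.
move=> [x0 Ux0]; split.
  move=> [p [[sp p2 cp] pw]].
  have {}cp := (conserved_quantity_coefficients U eta p sp).1 cp.
  have [a p0x] := vlineP _ _ (pw x0 Ux0).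
  have p0E x : U x -> p 0%N x = a *: w.
    move=> Ux; rewrite -p0x; apply: constant_coefficient => //.
      exact: sp.
    by move=> z X Uz; have [] := cp z X Uz.
  apply: (mean_curvature_equations_of_conserved J U w F Fu Fv N E
    ('D_e_u theta) ('D_e_v theta) k1 k2 H (skew_curvature theta k1 k2)
    ('D_e_u H) ('D_e_v H) ('D_e_u ('D_e_u H)) ('D_e_v ('D_e_u H))
    ('D_e_v ('D_e_v H)) Jsym oU cU S a (p 1%N) (p 2%N)) => //; try exact: sp.
  move=> x Ux; have [eu ev] := isothermic_formE x Ux.
  have fr := frameP S x Ux; have k0 := factor_neq0 S x.
  have [_ u1 u2 u3] := cp x e_u Ux; have [_ v1 v2 v3] := cp x e_v Ux.
  have d (q : plane R -> vec5 R) X m : smooth U q -> 'D_X q x + m = 0 ->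
      is_derive x X q (- m).
    move=> sq /eqP; rewrite addr_eq0 => /eqP e.
    exact: (is_derive_eq (smooth_is_derive X sq Ux) e).
  have [wu wv] := frame_form_w J _ _ _ _ _ _ _ a fr.
  split.
  - apply: (is_derive_eq (d _ _ _ (sp 1%N isT) u1)).
    apply: (etrans (congr1 (fun z => - (eta x e_u *m z)) (p0E x Ux))).
    apply: (etrans (congr1 -%R (eu _))); exact: (etrans (opprK _) wu).
  - apply: (is_derive_eq (d _ _ _ (sp 1%N isT) v1)).
    apply: (etrans (congr1 (fun z => - (eta x e_v *m z)) (p0E x Ux))).
    apply: (etrans (congr1 -%R (etrans (ev _) wv))).
    exact: (etrans (congr1 -%R (scaleNr _ _)) (opprK _)).
  - apply: (is_derive_eq (d _ _ _ (sp 2%N isT) u2)).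
    exact: (etrans (congr1 -%R (eu _)) (opprK _)).
  - apply: (is_derive_eq (d _ _ _ (sp 2%N isT) v2)).
    exact: (etrans (congr1 -%R (ev _)) (esym (scaleNr _ _))).
  - exact: (frame_form_kernel J _ _ _ _ _ _ _ _ k0 fr
      (etrans (esym (eu _)) u3) (etrans (esym (ev _)) v3)).
move=> [A [B [C eqs]]].
pose q1 := middle_coefficient J w F Fu Fv N H (skew_curvature theta k1 k2)
  ('D_e_u H) ('D_e_v H) A C.
pose q2 := top_coefficient F N H.
have sq1 : smooth U q1.
  exact: (smooth_middle_coefficient J U w F Fu Fv N _ _ _ _ _ _ _ _ _ _ _ _ oU
    S A C).
have sq2 : smooth U q2.
  exact: (smooth_top_coefficient J U w F Fu Fv N _ _ _ _ _ _ _ _ _ _ _ _ oU S).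
(* Here b = (N,q2) = 1, so that a = B. *)
pose p (k : nat) : plane R -> vec5 R :=
  match k with 0 => cst (B *: w) | 1 => q1 | _ => q2 end.
have sp k : (k <= 2)%N -> smooth U (p k).
  by move=> _; case: k => [|[|k]] //; exact: (smooth_cst oU).
exists p; split; last by move=> x _; rewrite memvZ// memv_line.
split=> //.
  exists x0; split=> //.
  exact: (top_coefficient_neq0 J U w F Fu Fv N _ _ _ _ _ _ _ _ _ _ _ _ Jsym S).
apply/(conserved_quantity_coefficients U eta p sp) => x X Ux.
have [eu ev] := isothermic_formE x Ux.
have [[_ u1] [_ v1] [_ u2] [_ v2] [f0 a0 b0]] :=
  conserved_of_mean_curvature_equations J U w F Fu Fv N E _ _ _ _ _ _ _ _ _ _ _
    Jsym S A B C eqs x Ux.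
have [wu wv] := frame_form_w J _ _ _ _ _ _ _ B (frameP S x Ux).
have comb0 (s t : R) (y y' z z' : vec5 R) : y + y' = 0 -> z + z' = 0 ->
    s *: y + t *: z + (s *: y' + t *: z') = 0.
  by move=> hy hz; rewrite addrACA -!scalerDr hy hz !scaler0 addr0.
have lin (q : plane R -> vec5 R) y : smooth U q ->
    'D_e_u q x + eta x e_u *m y = 0 -> 'D_e_v q x + eta x e_v *m y = 0 ->
    'D_X q x + eta x X *m y = 0.
  move=> sq hu hv; apply: (etrans (congr2 +%R
    (smooth_mx_deriveE oU X sq Ux) (isothermic_form_linear x X y))).
  exact: comb0 hu hv.
split.
- exact: derive_cst.
- apply: (lin q1 _ sq1).
    apply: (etrans (congr2 +%R u1 (eu _))).
    by apply: (etrans (congr1 (fun z => _ - z) wu)); rewrite subrr.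
  apply: (etrans (congr2 +%R v1 (etrans (ev _) wv))).
  by rewrite scaleNr subrr.
- apply: (lin q2 _ sq2).
    by apply: (etrans (congr2 +%R u2 (eu _))); rewrite subrr.
  by apply: (etrans (congr2 +%R v2 (ev _))); rewrite scaleNr addNr.
- have kill (y z : vec5 R) (s t : R) : s = 0 -> t = 0 -> s *: y - t *: z = 0.
    by move=> -> ->; rewrite !scale0r subrr.
  have zu := etrans (eu _) (congr1 (fun z => - (_ *: z)) (kill _ _ _ _ f0 a0)).
  have zv := etrans (ev _) (congr1 (fun z => _ *: z) (kill _ _ _ _ f0 b0)).
  apply: (etrans (isothermic_form_linear _ _ _)).
  apply: (etrans (congr2 (fun y z => _ *: y + _ *: z) zu zv)).
  by rewrite !(scaler0, oppr0) addr0.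
Qed.

End SpecialIsothermic.

Theorem theorem2p6 (R : realType) (J : 'M[R]_5) (U : set (plane R))
  (Lam : plane R -> {vspace vec5 R})
  (eta : plane R -> {linear plane R -> 'M[R]_5})
  (w : vec5 R) (F N : plane R -> vec5 R) (theta k1 k2 : plane R -> R^o)
  (hJ : signature41 J) (oU : open U) (cU : connected U)
  (hiso : isothermic J U Lam eta)
  (hw : w != 0)
  (hF : is_lift U Lam F) (hFw : forall x, U x -> space_form J w (F x))
  (hcorr : coordinates_correspond J U Lam eta)
  (htheta : smooth U theta) (hk1 : smooth U k1) (hk2 : smooth U k2)
  (hI : conformal J U F theta)
  (hN : unit_normal J U w F N)
  (hII : second_form J U F N theta k1 k2) :
  let H : plane R -> R^o := fun x => (k1 x + k2 x) / 2 in
  let L : plane R -> R^o := fun x => expR (2 * theta x) * (k1 x - k2 x) in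
  let M : plane R -> R^o := fun x => - (H x * L x) in
  special_isothermic J U Lam eta 2 w <->
  exists A B C : R, forall x, U x ->
    'D_e_u ('D_e_u H) x + 'D_e_u theta x * 'D_e_u H x
      - 'D_e_v theta x * 'D_e_v H x - 1 / 2 * M x * k1 x - A * k1 x
      - B * expR (- 2 * theta x) + C - 1 / 2 * L x * ip J w w = 0 /\
    'D_e_v ('D_e_v H) x - 'D_e_u theta x * 'D_e_u H x
      + 'D_e_v theta x * 'D_e_v H x + 1 / 2 * M x * k2 x + A * k2 x
      - B * expR (- 2 * theta x) - C + 1 / 2 * L x * ip J w w = 0.
Proof.
move=> H L M; have Jsym := signature41_sym J hJ.
have exU : exists x, U x by case: hiso => _ _ _ [x [X [Ux _]]] _; exists x.
have equiv := special_isothermic_equations J U Lam eta w F N theta k1 k2 Jsym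
  oU cU hF hFw hcorr htheta hk1 hk2 hI hN hII exU.
have e := inv_conformal_factor theta.
split=> [[_ /equiv[A [B [C eqs]]]]|[A [B [C eqs]]]].
  exists A, B, C => x Ux; have [eu ev] := eqs x Ux; split.
    exact: (etrans (congr1 (fun z => _ - B * z + C - _) (e x)) eu).
  exact: (etrans (congr1 (fun z => _ - B * z - C + _) (e x)) ev).
split=> //; apply/equiv; exists A, B, C => x Ux.
have [eu ev] := eqs x Ux; split.
  exact: (etrans (congr1 (fun z => _ - B * z + C - _) (esym (e x))) eu).
exact: (etrans (congr1 (fun z => _ - B * z - C + _) (esym (e x))) ev).
Qed.
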